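(* Let $k\ge 1$ be an integer, and let $T$ and $T'$ be two non-isomorphic PTE-trees with associated sequences $p$ and $p'$, respectively. Then $T$ and $T'$ have the same $U_{k+1}$-polynomial if and only if $p$ and $p'$ are solutions for the Prouhet-Tarry-Escott problem with degree $k$, that is, $p=_k p'$.
   Context: $U_k$-polynomial: let $x_1,x_2,\ldots$ be commuting indeterminates. For a partition $\lambda=(\lambda_1,\ldots,\lambda_l)$ put $\mathbf{x}_\lambda=x_{\lambda_1}\cdots x_{\lambda_l}$. For a tree $T=(V,E)$ and $A\subseteq E$, let $\lambda(A)$ be the partition of $|V|$ whose parts are the numbers of vertices of the connected components of the spanning subgraph $(V,A)$. For a positive integer $k$, $U_k(T)=\sum_{A\subseteq E,\ |A|\le k}\mathbf{x}_{\lambda(E\setminus A)}$. PTE-trees: an $n$-path is a path with $n$ vertices, and an $n$-star is $K_{1,n-1}$. For non-negative integers $a,b$, $B(a,b)$ is the rooted tree obtained from $a$ disjoint copies of the 4-path and $b$ disjoint copies of the 4-star by identifying one leaf of each copy into a single common vertex, the root; $B(0,0)$ is a single vertex. For sequences $p=(p_1,\ldots,p_n)$, $s=(s_1,\ldots,s_n)$ of non-negative integers with $n\ge 2$, $T(p,s)$ is the tree obtained from the disjoint union of $B(p_1,s_1),\ldots,B(p_n,s_n)$, with roots $v_1,\ldots,v_n$, by adding a new vertex $c$ joined by an edge to each $v_i$. For a positive integer $\alpha$, a sequence $p=(p_1,\ldots,p_n)$ of non-negative integers is $\alpha$-compatible if $n\ge2$ and $\max_i p_i\le\alpha$; then $T_\alpha(p):=T(p,\alpha-p)$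 where $\alpha-p=(\alpha-p_1,\ldots,\alpha-p_n)$. A tree $T$ is a PTE-tree if there exist a positive integer $\alpha$ and an $\alpha$-compatible sequence $p$ such that $T$ is isomorphic to $T_\alpha(p)$; the sequence $p$ is the sequence associated with $T$. Prouhet-Tarry-Escott problem: for an integer $k\ge1$, integer sequences $a=(a_1,\ldots,a_n)$ and $b=(b_1,\ldots,b_n)$ of the same length are solutions of degree $k$, written $a=_k b$, if they are distinct up to permutation and $\sum_{i=1}^n a_i^\ell=\sum_{i=1}^n b_i^\ell$ for all $1\le\ell\le k$.
   Formalization: The direction ''p =_k p' implies equal U_{k+1}-polynomials'' is stated only for PTE-trees T and T' with the same α; for different α it is false, since the trees then have different numbers of vertices. The other direction is unrestricted. *)

(* Defs.v *)
From HB Require Import structures.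
From mathcomp Require Import all_boot all_algebra.
From mathcomp.multinomials Require Import monalg.

Set Implicit Arguments.
Unset Strict Implicit.
Unset Printing Implicit Defensive.

Import GRing.Theory.

(** * Finite simple graphs and trees *)

Record sgraph := SGraph {
  vertex :> finType;
  adj : rel vertex;
  adj_sym : symmetric adj;
  adj_irr : irreflexive adj }.

Definition isomorphic (G H : sgraph) : Prop :=
  exists f : G -> H, bijective f /\ forall x y, adj (f x) (f y) = adj x y.

(* A [ucycle] of size 1 cannot occur (no loops), and one of size 2 only goes
   back and forth along an edge; genuine cycles have at least 3 vertices. *)
Definition is_tree (G : sgraph) : Prop :=
  [/\ 0 < #|G|,
      forall x y : G, connect (@adj G) x y
    & forall c : seq G, ucycle (@adj G) c -> size c < 3].

Definition edges (G : sgraph) : {set {set G}} :=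
  [set e : {set G} | [exists x : G, exists y : G,
    adj x y && (e == [set x; y])]].

(** * The [U_k]-polynomial *)

Definition span_adj (G : sgraph) (A : {set {set G}}) : rel G :=
  [rel x y | [set x; y] \in A].

Definition components (G : sgraph) (A : {set {set G}}) : {set {set G}} :=
  equivalence_partition (connect (span_adj A)) [set: G].

Definition lambda (G : sgraph) (A : {set {set G}}) : seq nat :=
  sort geq [seq #|C : {set G}| | C <- enum (components A)].

(* Integer polynomials in the indeterminates [x_i], i : nat; [x_0] never
   occurs, since the parts of a partition are positive. *)
Definition xpoly : comNzRingType := {malg int[{cmonom nat}]}.

Definition x_ (i : nat) : xpoly := << @ucm nat i >>%R.

Definition x_part (l : seq nat) : xpoly := (\prod_(i <- l) x_ i)%R.

Definition Upoly (k : nat) (G : sgraph) : xpoly :=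
  (\sum_(A : {set {set G}} | (A \subset edges G) && (#|A| <= k)%N)
     x_part (lambda (edges G :\: A)))%R.

(** * PTE-trees *)

(* The 4-path 0 - 1 - 2 - 3 and the 4-star with centre 1 and leaves 0, 2, 3.
   In both of them the vertex 0 is a leaf. *)
Definition path4 : rel 'I_4 :=
  [rel u v : 'I_4 | (v == u.+1 :> nat) || (u == v.+1 :> nat)].

Definition star4 : rel 'I_4 :=
  [rel u v : 'I_4 | (u != v) && ((u == 1 :> nat) || (v == 1 :> nat))].

Lemma path4_sym : symmetric path4.
Proof. by move=> u v; rewrite /path4 /= orbC. Qed.

Lemma path4_irr : irreflexive path4.
Proof. by move=> u; rewrite /path4 /= orbb eqn_leq ltnn andbF. Qed.

Lemma star4_sym : symmetric star4.
Proof. by move=> u v; rewrite /star4 /= eq_sym orbC. Qed.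

Lemma star4_irr : irreflexive star4.
Proof. by move=> u; rewrite /star4 /= eqxx. Qed.

Section B.
Variables a b : nat.

Definition copy : finType := ('I_a + 'I_b)%type.

Definition copy_adj (i : copy) : rel 'I_4 :=
  match i with inl _ => path4 | inr _ => star4 end.

(* [None] is the root, i.e. the common image of the vertices 0 of all copies;
   [Some (i, w)] is the vertex w + 1 of the copy i. *)
Definition Bvertex : finType := option (copy * 'I_3).

Definition glue (i : copy) (u : 'I_4) : Bvertex :=
  omap (pair i) (unlift ord0 u).

Definition Badj : rel Bvertex :=
  [rel x y | [exists i : copy, exists u : 'I_4, exists v : 'I_4,
    [&& copy_adj i u v, glue i u == x & glue i v == y]]].

Lemma copy_adj_sym i : symmetric (copy_adj i).
Proof. by case: i => ?; [apply: path4_sym | apply: star4_sym]. Qed.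

Lemma copy_adj_irr i : irreflexive (copy_adj i).
Proof. by case: i => ?; [apply: path4_irr | apply: star4_irr]. Qed.

Lemma glue_inj i : injective (glue i).
Proof.
move=> u v; rewrite /glue.
by case: unliftP => [u' ->|->]; case: unliftP => [v' ->|->] //= [->].
Qed.

Lemma Badj_sym : symmetric Badj.
Proof.
suff S x y : Badj x y -> Badj y x by move=> x y; apply/idP/idP; apply: S.
case/existsP=> i /existsP[u /existsP[v /and3P[uv xE yE]]].
apply/existsP; exists i; apply/existsP; exists v; apply/existsP; exists u.
by rewrite copy_adj_sym uv xE yE.
Qed.

Lemma Badj_irr : irreflexive Badj.
Proof.
move=> x; apply/existsP => -[i /existsP[u /existsP[v]]].
by case/and3P=> uv /eqP <- /eqP/glue_inj vu; rewrite vu copy_adj_irr in uv.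
Qed.

Definition Bgraph : sgraph := SGraph Badj_sym Badj_irr.

Definition Broot : Bgraph := None.

End B.

Section PTEgraph.
Variables (n : nat) (p s : n.-tuple nat).

(* [None] is the new vertex c. *)
Definition PTEvertex : finType :=
  option {i : 'I_n & Bgraph (tnth p i) (tnth s i)}.

Definition PTEadj : rel PTEvertex := fun x y =>
  match x, y with
  | None, None => false
  | None, Some v | Some v, None => tagged v == Broot _ _
  | Some u, Some v => (tag u == tag v) && adj (tagged u) (tagged_as u v)
  end.

Lemma PTEadj_sym : symmetric PTEadj.
Proof.
case=> [[i u]|] [[j v]|] //=; have [ij|//] := eqVneq i j.
by case: _ / ij v => v; rewrite !tagged_asE; apply: Badj_sym.
Qed.

Lemma PTEadj_irr : irreflexive PTEadj.
Proof. by case=> [[i u]|] //; rewrite /PTEadj eqxx tagged_asE; apply: Badj_irr. Qed.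

Definition PTEgraph : sgraph := SGraph PTEadj_sym PTEadj_irr.

End PTEgraph.

Definition compatible (alpha : nat) (p : seq nat) : Prop :=
  [/\ 0 < alpha, 2 <= size p & \max_(a <- p) a <= alpha].

Definition T_ (alpha : nat) (p : seq nat) : sgraph :=
  PTEgraph (in_tuple p) [tuple of [seq alpha - a | a <- in_tuple p]].

Definition PTE_tree (alpha : nat) (p : seq nat) (G : sgraph) : Prop :=
  [/\ is_tree G, compatible alpha p & isomorphic G (T_ alpha p)].

(** * The Prouhet-Tarry-Escott problem *)

Definition PTE_solutions (k : nat) (a b : seq int) : Prop :=
  [/\ size a = size b,
      ~~ perm_eq a b
    & forall l : nat, 1 <= l <= k ->
        (\sum_(x <- a) x ^+ l = \sum_(x <- b) x ^+ l)%R].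

(* Main.v *)
From HB Require Import structures.
Require Import Defs.
From mathcomp Require Import all_boot all_algebra.
From mathcomp Require Import finmap.
From mathcomp.multinomials Require Import monalg.
From mathcomp Require Import ring zify.

Set Implicit Arguments.
Unset Strict Implicit.
Unset Printing Implicit Defensive.

Import GRing.Theory.

(** Cutting [m] edges of a tree leaves [m + 1] components, so [Upoly k] records,
for every [m <= k], the sum over all sets of [m] edges of the product of the
[x_i] over the component sizes [i]. Root the tree, cut below a vertex, and mark
the component of the root by [y ^ size] and each cut by [q]. The resulting
polynomial [F_v] of the subtree hanging at [v] satisfies
  [F_v = y * prod_c (F_c + q * L F_c)],
the product over the children [c] of [v], where [L] closes the component of the
root, replacing [y ^ i] by [x_i] ([desc_sum_children]).

Let [S] and [P] be the factors contributed by a copy of the 4-star and of the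
4-path. They agree up to one cut: [P = S + q * D]. Hence the bunch
[B(a, alpha - a)] has the polynomial
  [F(a) = y * P ^ a * S ^ (alpha - a) = sum_j 'C(a, j) * q ^ j * (...)],
whose coefficient of [q ^ j] is a polynomial of degree at most [j] in [a]. In
other words, up to the factor [alpha!], [F(a)] is a polynomial in [q * a] with
coefficients free of [a] ([bunchE], [binom_sumE]). The whole tree has the
polynomial [y * prod_i G(p_i)] with [G(a) = F(a) + q * L F(a)]. Put
[K = (P * S) ^ alpha] and [H(a) = P ^ (alpha - a) * S ^ a * L F(a)]; then
  [(y * K) ^ n * prod_i G(p_i) = prod_i F(p_i) * prod_i (y * K + q * H(p_i))].
The first product depends on [sum_i p_i] only. In the second one every [H(p_i)]
comes with a factor [q], and by Newton's identities the elementary symmetric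
functions of the [H(p_i)] modulo [q ^ (k + 1)] are determined by the power sums
[sum_i H(p_i) ^ j], that is, by the power sums of [p] of degree at most [k].
Since [y * K] can be cancelled modulo powers of [q], the power sums of degree at
most [k] determine [Upoly k.+1] ([eqm_prod_branch], [psum_Upoly]).

Conversely, the number [n] of bunches, [alpha] and [sum_i p_i] are read off from
the cuts of at most one edge ([sizes_invariant], [psum1_invariant]). If the power
sums of degree less than [l] agree, then the two coefficients of [q ^ (l + 1)]
differ by a multiple of the difference of the power sums of degree [l]
([zlin_prod_branch]); for [l <= alpha] a specialization of the [x_i] shows that
the multiplier is not zero ([psum_step]). The restriction to [l <= alpha] is
harmless, because power sums of degree at most [alpha] determine a sequence with
entries in [0, ..., alpha] up to order ([psum_perm_eq]), and permuted sequences
give isomorphic trees ([perm_eq_isomorphic]). *)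

(** * Polynomials modulo a power of the variable *)

Section Truncation.
Variable A : comNzRingType.
Implicit Types f g h : {poly A}.
Local Open Scope ring_scope.

Definition eqm l f g := forall i, (i < l)%N -> f`_i = g`_i.

Lemma eqm_refl l f : eqm l f f. Proof. by []. Qed.

Lemma eqm_le l l' f g : (l <= l')%N -> eqm l' f g -> eqm l f g.
Proof. by move=> ll fg i il; apply/fg/(leq_trans il). Qed.

Lemma eqmD l f g f' g' : eqm l f g -> eqm l f' g' -> eqm l (f + f') (g + g').
Proof. by move=> fg fg' i il; rewrite !coefD fg ?fg'. Qed.

Lemma eqmM l f g f' g' : eqm l f g -> eqm l f' g' -> eqm l (f * f') (g * g').
Proof.
move=> fg fg' i il; rewrite !coefM; apply: eq_bigr => j _.
rewrite fg ?fg' //; first by apply: leq_ltn_trans il; apply: leq_subr.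
by apply: leq_ltn_trans il; rewrite -ltnS.
Qed.

Lemma eqm_sum l (I : Type) (r : seq I) (P : pred I) (F G : I -> {poly A}) :
  (forall i, P i -> eqm l (F i) (G i)) ->
  eqm l (\sum_(i <- r | P i) F i) (\sum_(i <- r | P i) G i).
Proof. by move=> FG; apply: big_ind2 => // *; apply: eqmD. Qed.

Lemma eqm_XnM l m f g : eqm l f g -> eqm (m + l) ('X^m * f) ('X^m * g).
Proof.
move=> fg i il; rewrite !coefXnM; case: ltnP => // mi.
by apply: fg; rewrite ltn_subLR.
Qed.

(** The constant coefficient of [f * g] is the product of the constant
coefficients, so [f] can be cancelled degree by degree. *)
Lemma eqm_mulI l f g h : GRing.lreg f`_0 -> eqm l (f * g) (f * h) -> eqm l g h.
Proof.
move=> f0 fgh i; elim/ltn_ind: i => i IH il; apply/eqP; rewrite -subr_eq0.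
apply/eqP/f0; have := fgh i il => /eqP; rewrite -subr_eq0 -coefB -mulrBr coefM.
rewrite big_ord_recl big1 /= => [|j _]; first by rewrite addr0 subn0 coefB mulr0 => /eqP.
have ji: (i - bump 0 j < i)%N by rewrite ltn_subrL /= (leq_ltn_trans _ (ltn_ord j)).
by rewrite coefB IH ?subrr ?mulr0 // (ltn_trans ji).
Qed.

Lemma coefM_lowest f g m :
  (forall i, (i < m)%N -> g`_i = 0) -> (f * g)`_m = f`_0 * g`_m.
Proof.
move=> g0; rewrite coefM big_ord_recl big1 /= ?addr0 ?subn0 // => i _.
by rewrite g0 ?mulr0 // ltn_subrL /= (leq_ltn_trans _ (ltn_ord i)).
Qed.

Lemma coef0X f n : (f ^+ n)`_0 = f`_0 ^+ n.
Proof. by elim: n => [|n IH]; rewrite ?coef1 // !exprS coef0M IH. Qed.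

Lemma coef1_prod (u : A) (s : seq {poly A}) :
  all (fun f : {poly A} => f`_0 == u) s ->
  (\prod_(f <- s) f)`_1 = \sum_(f <- s) f`_1 * u ^+ (size s).-1.
Proof.
elim: s => [|f s IH] /=; first by rewrite !big_nil coef1.
case/andP=> /eqP f0 su; rewrite !big_cons coefM !big_ord_recl big_ord0 addr0 /=.
rewrite /bump /= subnn subn0 IH // f0 addrC; congr (_ + _).
  rewrite coef0_prod; congr (_ * _); elim: s su {IH} => [|g s IH] /=.
    by rewrite big_nil.
  by case/andP=> /eqP g0 su; rewrite big_cons g0 IH // exprS.
rewrite mulr_sumr; case: s {su IH} => [|g s]; first by rewrite !big_nil.
by apply: eq_bigr => h _; rewrite mulrCA -exprS.
Qed.

End Truncation.

(** * Newton's identities *)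

Section Newton.
Variable B : comNzRingType.
Implicit Types (x : B) (s : seq B).
Local Open Scope ring_scope.

Fixpoint elsym m s : B :=
  match s, m with
  | _, 0 => 1
  | [::], _.+1 => 0
  | x :: s', m'.+1 => elsym m s' + x * elsym m' s'
  end.

Arguments elsym : simpl never.

Lemma elsymS m x s : elsym m.+1 (x :: s) = elsym m.+1 s + x * elsym m s.
Proof. by []. Qed.

Lemma elsym0 s : elsym 0 s = 1. Proof. by case: s. Qed.

Lemma elsym_large m s : (size s < m)%N -> elsym m s = 0.
Proof.
elim: s m => [|x s IH] [|m] //= sm.
by rewrite elsymS !IH ?mulr0 ?addr0 // ltnW.
Qed.

Lemma elsym1 s : elsym 1 s = \sum_(x <- s) x.
Proof.
elim: s => [|x s IH]; first by rewrite big_nil.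
by rewrite elsymS big_cons IH elsym0 mulr1 addrC.
Qed.

Lemma prod_elsym (c q : B) s :
  \prod_(x <- s) (c + q * x)
    = \sum_(m < (size s).+1) c ^+ (size s - m) * q ^+ m * elsym m s.
Proof.
elim: s => [|x s IH]; first by rewrite big_nil big_ord1 /= !mulr1.
rewrite big_cons IH mulrDl /= [RHS]big_ord_recl /= !mulr1.
under [in RHS]eq_bigr => m _ do rewrite /bump leq0n add1n subSS elsymS mulrDr.
rewrite big_split /= addrA; congr (_ + _); last first.
  by rewrite mulr_sumr; apply: eq_bigr => m _; rewrite exprS; ring.
rewrite mulr_sumr big_ord_recl elsym0 subn0 !mulr1 -exprS subn0; congr (_ + _).
rewrite [in RHS]big_ord_recr /= elsym_large // mulr0 addr0.
apply: eq_bigr => m _; rewrite /bump leq0n add1n.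
by rewrite !mulrA -exprS subnSK.
Qed.

(** Beyond the constant and the linear term, every elementary symmetric function
carries a factor [q ^ 2]: knowing them modulo [q ^ l] gives the right-hand side
modulo [q ^ (l + 2)]. *)
Lemma prod_elsym_tail (c q x : B) s :
  \prod_(z <- x :: s) (c + q * z) - c ^+ size s * (q * \sum_(z <- x :: s) z)
    = c ^+ (size s).+1 + \sum_(m < size s)
        c ^+ (size s - m.+1) * (q ^+ m.+2 * elsym m.+2 (x :: s)).
Proof.
rewrite prod_elsym -elsym1 !big_ord_recl addrCA addrC subn0 expr0 mulr1.
rewrite elsym0 mulr1 /bump /= subn1 expr1 -mulrA addrK; congr (_ + _).
by apply: eq_bigr => m _; rewrite mulrA.
Qed.

(** The right-hand side of Newton's identity for [elsym m s *+ m]. *)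
Definition newton_sum m s : B :=
  \sum_(j < m) (-1) ^+ j * elsym (m - j.+1) s * \sum_(x <- s) x ^+ j.+1.

(** The contribution of the powers of a new entry [x] to [newton_sum]: by
[elsymS], consecutive terms cancel. *)
Lemma newton_telescope m x s :
  \sum_(j < m.+1) (-1) ^+ j * x ^+ j.+1 * elsym (m - j) (x :: s) = x * elsym m s.
Proof.
elim: m => [|m IH]; first by rewrite big_ord1 !elsym0; ring.
rewrite big_ord_recl /= subn0 expr0 expr1 mul1r.
rewrite (eq_bigr (fun j : 'I_m.+1 =>
  - x * ((-1) ^+ j * x ^+ j.+1 * elsym (m - j) (x :: s)))) => [|j _].
  by rewrite -mulr_sumr IH elsymS; ring.
by rewrite /bump leq0n add1n subSS (exprS _ j) (exprS _ j.+1); ring.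
Qed.

Lemma newton m s : elsym m s *+ m = newton_sum m s.
Proof.
elim: s m => [|x s IH] [|m]; rewrite /newton_sum ?mulr0n ?big_ord0 //.
  by rewrite mul0rn big1 // => j _; rewrite big_nil mulr0.
under eq_bigr => j _ do rewrite subSS big_cons mulrDr mulrAC.
rewrite big_split /= newton_telescope.
have -> : \sum_(i < m.+1) (-1) ^+ i * elsym (m - i) (x :: s) * \sum_(j <- s) j ^+ i.+1
        = newton_sum m.+1 s + x * newton_sum m s.
  rewrite /newton_sum [in LHS]big_ord_recr [in RHS]big_ord_recr /= !subnn !elsym0.
  rewrite addrAC; congr (_ + _); rewrite mulr_sumr -big_split /=.
  apply: eq_bigr => j _; rewrite subSS -(subnSK (ltn_ord j)) elsymS; ring.
by rewrite -!IH elsymS; ring.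
Qed.

End Newton.

Arguments elsym : simpl never.

(** Newton's identities have to be divided by [m]; nothing more than cancelling
positive integers is asked from the coefficients, so that integral polynomials
need not be extended to rational ones. *)
Definition torsion_free (V : zmodType) :=
  forall (m : nat) (v : V), 0 < m -> (v *+ m = 0)%R -> (v = 0)%R.

Lemma torsion_free_poly (A : nzRingType) :
  torsion_free A -> torsion_free {poly A}.
Proof.
move=> tfA m f m0 fm; apply/polyP => i; rewrite coef0.
by apply: (tfA m) => //; rewrite -coefMn fm coef0.
Qed.

Section SymmetricProducts.
Variable A : comNzRingType.
Hypothesis tfA : torsion_free A.
Implicit Types s : seq {poly A}.
Local Open Scope ring_scope.

(** By Newton's identities, solved for [elsym m s] by induction on [m]. *)
Lemma eqm_elsym l s s' m :
  (forall j, eqm l (\sum_(x <- s) x ^+ j.+1) (\sum_(x <- s') x ^+ j.+1)) ->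
  eqm l (elsym m s) (elsym m s').
Proof.
move=> ps; elim/ltn_ind: m => -[|m] IH; first by rewrite !elsym0.
move=> i il; apply/eqP; rewrite -subr_eq0 -coefB; apply/eqP.
apply: (tfA (ltn0Sn m)); rewrite -coefMn mulrnBl coefB !newton.
apply/eqP; rewrite subr_eq0; apply/eqP; move: i il; apply: eqm_sum => j _.
by apply: eqmM => //; apply: eqmM => //; apply: IH; rewrite subSS ltnS leq_subr.
Qed.

(** Power sums known modulo ['X^l] give the product modulo ['X^(l + 2)] once its
linear term is removed: this term needs one more coefficient of the sum of the
entries, all others are covered by [eqm_elsym]. *)
Lemma eqm_prod_elsym l (c : {poly A}) s s' : size s = size s' ->
  (forall j, eqm l (\sum_(x <- s) x ^+ j.+1) (\sum_(x <- s') x ^+ j.+1)) ->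
  eqm l.+2
    (\prod_(x <- s) (c + 'X * x) - c ^+ (size s).-1 * ('X * \sum_(x <- s) x))
    (\prod_(x <- s') (c + 'X * x) - c ^+ (size s).-1 * ('X * \sum_(x <- s') x)).
Proof.
move=> ss' ps; case: s s' ss' ps => [|x s] [|x' s'] // [ss'] ps.
have tail' := prod_elsym_tail c 'X x' s'; rewrite -ss' in tail'.
rewrite prod_elsym_tail tail'; apply: eqmD => //.
apply: eqm_sum => m _; apply: eqmM => //.
apply: (@eqm_le _ _ (m.+2 + l)); first by rewrite !addSn !ltnS leq_addl.
exact/eqm_XnM/eqm_elsym.
Qed.

End SymmetricProducts.

(** * Families depending polynomially on an exponent *)

Definition psum l (s : seq nat) := \sum_(a <- s) a ^ l.

Lemma psum0 s : psum 0 s = size s.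
Proof. by rewrite /psum sum1_size. Qed.

Lemma psum1 s : psum 1 s = \sum_(a <- s) a.
Proof. by []. Qed.

Section BinomialSums.
Variable A : comNzRingType.
Implicit Types (u : nat -> {poly A}) (Phi : {poly {poly A}}) (p : seq nat).
Local Open Scope ring_scope.

Definition binom_sum al u a : {poly A} := \sum_(j < al.+1) ('X^j * u j) *+ 'C(a, j).

(** The falling factorial of [a] times ['X^j] is the product of the
['X *+ a - 'X *+ i], hence [binom_sum al u a] is the value at ['X *+ a] of a
polynomial that does not mention [a], up to the factor [al`!] which clears the
denominators [j`!]; note that [al ^_ (al - j)] is the quotient of [al`!] by
[j`!]. *)
Definition binom_poly al u : {poly {poly A}} :=
  \sum_(j < al.+1) (u j *+ (al ^_ (al - j))) *: \prod_(i < j) ('X - ('X *+ i)%:P).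

Lemma prod_falling j a :
  \prod_(i < j) ('X *+ a - 'X *+ i) = 'X^j *+ (a ^_ j) :> {poly A}.
Proof.
elim: j => [|j IH]; first by rewrite big_ord0 ffactn0.
rewrite big_ord_recr /= IH ffactnSr; have [ja|aj] := leqP j a.
  by rewrite -(mulrnBr _ ja) mulrnAl mulrnAr -exprSr -mulrnA mulnC.
by rewrite ffact_small // mul0n mul0r.
Qed.

Lemma binom_sumE al u a : binom_sum al u a *+ al`! = (binom_poly al u).['X *+ a].
Proof.
rewrite /binom_sum /binom_poly horner_sum -sumrMnl; apply: eq_bigr => j _.
rewrite hornerZ horner_prod.
under [in RHS]eq_bigr => i _ do rewrite hornerD hornerN hornerX hornerC.
have jal: (j <= al)%N by rewrite -ltnS.
have := ffact_fact (leq_subr j al); rewrite subKn // => <-.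
rewrite prod_falling mulrnAl mulrnAr mulrC -!mulrnA -(bin_ffact a j).
by rewrite -mulnA [(j`! * _)%N]mulnC.
Qed.

(** At ['X = 0] the product in [binom_poly] collapses to a power of its
variable. *)
Lemma coef0_binom_poly al u l : (l <= al)%N ->
  ((binom_poly al u)`_l)`_0 = (u l)`_0 *+ (al ^_ (al - l)).
Proof.
have [ev0 ev0E]: exists e : {rmorphism {poly A} -> A}, forall f, e f = f`_0.
  by exists (coefp 0).
move=> lal; rewrite -ev0E -coef_map /binom_poly rmorph_sum coef_sum.
have term j : map_poly ev0 ((u j *+ al ^_ (al - j)) *:
    \prod_(i < j) ('X - ('X *+ i)%:P)) = ((u j)`_0 *+ al ^_ (al - j)) *: 'X^j.
  rewrite map_polyZ ev0E coefMn rmorph_prod (eq_bigr (fun=> 'X)) => [|i _].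
    by rewrite prodr_const card_ord.
  by rewrite rmorphB /= map_polyX map_polyC /= ev0E coefMn coefX mul0rn subr0.
rewrite (bigD1 (Ordinal (lal : (l < al.+1)%N))) //= term coefZ coefXn eqxx mulr1.
rewrite big1 ?addr0 // => j jl; rewrite term coefZ coefXn.
case: eqP => [lj|_]; last by rewrite mulr0.
by case/eqP: jl; apply: val_inj.
Qed.

(** A value at ['X *+ a] couples [a ^ i] with ['X^i]; this is why the coefficient
of degree [l] sees the power sums of degree at most [l] only. *)
Lemma sum_horner Phi p :
  \sum_(a <- p) Phi.['X *+ a] = \sum_(i < size Phi) (Phi`_i * 'X^i) *+ psum i p.
Proof.
under eq_bigr => a _ do rewrite horner_coef.
rewrite exchange_big; apply: eq_bigr => i _ /=.
by rewrite /psum -sumrMnr; apply: eq_bigr => a _; rewrite exprMn_n mulrnAr.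
Qed.

Lemma eqm_sum_horner l Phi p p' :
  (forall i, (i < l)%N -> psum i p = psum i p') ->
  eqm l (\sum_(a <- p) Phi.['X *+ a]) (\sum_(a <- p') Phi.['X *+ a]).
Proof.
move=> pp'; rewrite !sum_horner; apply: eqm_sum => i _ m ml.
rewrite !coefMn coefMXn; case: ltnP => mi; first by rewrite !mul0rn.
by rewrite (pp' i (leq_ltn_trans mi ml)).
Qed.

Lemma coef_sum_horner l Phi p p' :
  (forall i, (i < l)%N -> psum i p = psum i p') ->
  (\sum_(a <- p) Phi.['X *+ a])`_l - (\sum_(a <- p') Phi.['X *+ a])`_l
    = (Phi`_l)`_0 *+ psum l p - (Phi`_l)`_0 *+ psum l p'.
Proof.
move=> pp'; rewrite !sum_horner !coef_sum -sumrB.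
have term i : ((Phi`_i * 'X^i) *+ psum i p)`_l - ((Phi`_i * 'X^i) *+ psum i p')`_l
   = if i == l then (Phi`_l)`_0 *+ psum l p - (Phi`_l)`_0 *+ psum l p' else 0.
  rewrite !coefMn coefMXn; have [il|li|->] := ltngtP i l.
  - by rewrite pp' ?subrr.
  - by rewrite !mul0rn subrr.
  - by rewrite subnn.
under eq_bigr => i _ do rewrite term.
rewrite -big_mkcond /=; have [lP|Pl] := ltnP l (size Phi).
  by rewrite (big_pred1 (Ordinal lP)).
rewrite big_pred0 ?(nth_default _ Pl) ?coef0 ?mul0rn ?subrr // => i.
by apply/negbTE; rewrite neq_ltn (leq_trans (ltn_ord i) Pl).
Qed.

End BinomialSums.

(** * Cut polynomials of bunches *)

Section Weights.
Variables (R : comNzRingType) (z : nat -> R).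
Implicit Types (f : {poly R}) (g : {poly {poly R}}) (p : seq nat).
Local Open Scope ring_scope.

(** In [{poly {poly R}}] the outer variable ['X] counts the cuts, the inner one
is the marker of the size of the component that contains the root. The numbers
[z i] stand for the indeterminates [x_i]. *)
Definition zlin f : R := \sum_(i < size f) f`_i * z i.

Lemma zlinE n f : (size f <= n)%N -> zlin f = \sum_(i < n) f`_i * z i.
Proof.
move=> fn; rewrite /zlin (big_ord_widen n (fun i => f`_i * z i)) //.
rewrite big_mkcond; apply: eq_bigr => i _; case: ltnP => // fi.
by rewrite nth_default ?mul0r.
Qed.

Fact zlin_is_linear : linear_for *%R zlin.
Proof.
move=> a f g; pose n := maxn (size f) (size g).
have fn : (size f <= n)%N by rewrite leq_maxl.
have gn : (size g <= n)%N by rewrite leq_maxr.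
have fgn : (size (a *: f + g)%R <= n)%N.
  by rewrite (leq_trans (size_polyD _ _)) // geq_max gn (leq_trans (size_scale_leq _ _)).
rewrite (zlinE fgn) (zlinE fn) (zlinE gn) mulr_sumr -big_split /=.
by apply: eq_bigr => i _; rewrite coefD coefZ mulrDl mulrA.
Qed.

HB.instance Definition _ :=
  GRing.isLinear.Build R {poly R} R *%R zlin zlin_is_linear.

Lemma zlinXn n : zlin 'X^n = z n.
Proof.
rewrite (@zlinE n.+1) ?size_polyXn // big_ord_recr /= coefXn eqxx mul1r.
by rewrite big1 ?add0r // => i _; rewrite coefXn ltn_eqF ?mul0r.
Qed.

Definition close_root : {poly {poly R}} -> {poly {poly R}} :=
  map_poly (polyC \o zlin).

HB.instance Definition _ := GRing.Additive.on close_root.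

Lemma coef_close_root g i : (close_root g)`_i = (zlin g`_i)%:P.
Proof. exact: coef_map. Qed.

Lemma close_rootXn j g : close_root ('X^j * g) = 'X^j * close_root g.
Proof.
apply/polyP => i; rewrite coef_close_root !coefXnM coef_close_root.
by case: ifP => // _; rewrite raddf0.
Qed.

Lemma close_rootC c g : close_root (c%:P%:P * g) = c%:P%:P * close_root g.
Proof.
apply/polyP => i; rewrite coef_close_root !coefCM coef_close_root.
by rewrite mul_polyC linearZ /= polyCM.
Qed.

Lemma close_root_polyC f : close_root f%:P = (zlin f)%:P%:P.
Proof. exact: map_polyC. Qed.

Definition yvar : {poly {poly R}} := 'X%:P.
Definition zconst i : {poly {poly R}} := (z i)%:P%:P.

(** The cuts of a copy of the 4-star that hangs at the root by an edge: with no
cut it adds three vertices to the component of the root; cutting the edge at the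
root separates three vertices, cutting any other edge separates a leaf, and so
on. *)
Definition star_copy : {poly {poly R}} :=
  yvar ^+ 3 + 'X * (zconst 1 * yvar ^+ 2 *+ 2 + zconst 3)
    + 'X^2 * (zconst 1 ^+ 2 * yvar + zconst 1 * zconst 2 *+ 2) + 'X^3 * zconst 1 ^+ 3.

(** A single cut separates 3, 2 or 1 vertices from a path copy, and 3, 1 or 1
vertices from a star copy; sets of two or three cuts give the same sizes in
both. *)
Definition copy_diff : {poly {poly R}} := zconst 2 * yvar - zconst 1 * yvar ^+ 2.

Definition path_copy : {poly {poly R}} := star_copy + 'X * copy_diff.

Definition bunch al a : {poly {poly R}} :=
  yvar * path_copy ^+ a * star_copy ^+ (al - a).

(** The bunch below the centre of the tree; the second term is the cut of the
edge to the centre. *)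
Definition branch al a : {poly {poly R}} :=
  bunch al a + 'X * close_root (bunch al a).

(** The binomial theorem for [S + 'X * D]; the exponents add up to [al], which
leaves powers of [S] that do not depend on [a]. *)
Lemma binom_sum_power (E D S : {poly {poly R}}) al a : (a <= al)%N ->
  E * (S + 'X * D) ^+ a * S ^+ (al - a)
    = binom_sum al (fun j => E * D ^+ j * S ^+ (al - j)) a.
Proof.
move=> aal; rewrite /binom_sum exprDn mulr_sumr mulr_suml.
pose F j := E * (S ^+ (a - j) * ('X * D) ^+ j *+ 'C(a, j)) * S ^+ (al - a).
rewrite (big_ord_widen al.+1 F) ?ltnS // /F.
rewrite big_mkcond; apply: eq_bigr => j _; case: ltnP => [ja|aj].
  have -> : (al - j = (a - j) + (al - a))%N by rewrite addnC addnBA // subnK.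
  by rewrite exprMn !(mulrnAl, mulrnAr) exprD; congr (_ *+ _); ring.
by rewrite bin_small // mulr0n.
Qed.

Definition bunch_coef al j := yvar * copy_diff ^+ j * star_copy ^+ (al - j).
Definition cobunch_coef al j := (- copy_diff) ^+ j * path_copy ^+ (al - j).

Lemma bunchE al a : (a <= al)%N -> bunch al a = binom_sum al (bunch_coef al) a.
Proof. exact: binom_sum_power. Qed.

Lemma close_bunchE al a : (a <= al)%N ->
  close_root (bunch al a) = binom_sum al (fun j => close_root (bunch_coef al j)) a.
Proof.
move=> aal; rewrite bunchE // /binom_sum raddf_sum; apply: eq_bigr => j _.
by rewrite raddfMn /= close_rootXn.
Qed.

Lemma cobunchE al a : (a <= al)%N ->
  star_copy ^+ a * path_copy ^+ (al - a) = binom_sum al (cobunch_coef al) a.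
Proof.
move=> aal; have := binom_sum_power 1 (- copy_diff) path_copy aal.
rewrite mul1r mulrN /path_copy addrK => ->.
by apply: eq_bigr => j _; rewrite mul1r.
Qed.

(** The quotient of the closed bunch by the open one, made a polynomial by the
factor [yvar * (path_copy * star_copy) ^+ al] of [clearing]; the factorials come
from [binom_sumE]. *)
Definition detach al a : {poly {poly R}} :=
  star_copy ^+ a * path_copy ^+ (al - a) * close_root (bunch al a) *+ (al`! * al`!).

Definition detach_poly al : {poly {poly {poly R}}} :=
  binom_poly al (cobunch_coef al) * binom_poly al (fun j => close_root (bunch_coef al j)).

Lemma detachE al a : (a <= al)%N ->
  detach al a = (detach_poly al).['X *+ a].
Proof.
move=> aal; rewrite /detach hornerM -!binom_sumE -cobunchE // -close_bunchE //.
by rewrite mulrnAl mulrnAr mulrnA.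
Qed.

Definition clearing al : {poly {poly R}} :=
  yvar * (path_copy * star_copy) ^+ al *+ (al`! * al`!).

(** Pulling the open bunch out of a branch leaves [1] plus ['X] times a quotient;
the open bunches multiply to something that only depends on the sum of the
exponents ([prod_bunch]). *)
Lemma clear_branch al a : (a <= al)%N ->
  clearing al * branch al a = bunch al a * (clearing al + 'X * detach al a).
Proof.
move=> aal; rewrite /branch !mulrDr mulrC; congr (_ + _).
rewrite /clearing /detach !(mulrnAl, mulrnAr); congr (_ *+ _).
set L := close_root _; have split_al x : x ^+ al = x ^+ a * x ^+ (al - a) :> {poly {poly R}}.
  by rewrite -exprD subnKC.
by rewrite /bunch exprMn !split_al; ring.
Qed.

Lemma clear_prod_branch al p : all (leq^~ al) p ->
  clearing al ^+ size p * \prod_(a <- p) branch al a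
   = \prod_(a <- p) bunch al a * \prod_(x <- map (detach al) p) (clearing al + 'X * x).
Proof.
rewrite big_map -big_split /=; elim: p => [|a p IH]; first by rewrite !big_nil mul1r.
case/andP=> aal pal; rewrite !big_cons -(IH pal) exprS -clear_branch //; ring.
Qed.

Lemma prod_bunch al p : all (leq^~ al) p ->
  \prod_(a <- p) bunch al a
   = yvar ^+ size p * path_copy ^+ psum 1 p * star_copy ^+ (size p * al - psum 1 p).
Proof.
have le_psum s : all (leq^~ al) s -> (psum 1 s <= size s * al)%N.
  elim: s => [|a s IH] /=; first by rewrite psum1 big_nil.
  by case/andP=> aal /IH; rewrite !psum1 big_cons mulSn; apply: leq_add.
elim: p => [|a p IH]; first by rewrite big_nil psum1 big_nil !mul1r.
case/andP=> aal pal; rewrite big_cons IH // !psum1 big_cons -psum1 /= /bunch.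
rewrite mulSn exprS exprD.
have -> : (al + size p * al - (a + psum 1 p) = (al - a) + (size p * al - psum 1 p))%N.
  by have := le_psum p pal; lia.
by rewrite exprD; ring.
Qed.

Lemma coef0_star_copy : star_copy`_0 = 'X^3.
Proof.
by rewrite /star_copy !coefD !coef0M coefX coefC /= !mul0r !addr0 !exprS mulr1.
Qed.

Lemma coef0_path_copy : path_copy`_0 = 'X^3.
Proof. by rewrite /path_copy coefD coefXM addr0 coef0_star_copy. Qed.

Lemma coef0_clearing al : (clearing al)`_0 = 'X^(6 * al + 1) *+ (al`! * al`!).
Proof.
rewrite /clearing coefMn; congr (_ *+ _).
rewrite coef0M coef0X coef0M coef0_path_copy coef0_star_copy coefC /= -exprD -exprM -exprS.
by congr ('X^_); lia.
Qed.

Lemma coef0_bunch al a : (a <= al)%N -> (bunch al a)`_0 = 'X^(3 * al + 1).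
Proof.
move=> aal; rewrite /bunch !coef0M !coef0X coef0_path_copy coef0_star_copy coefC /=.
by rewrite -!exprM -exprS -exprD; congr ('X^_); lia.
Qed.

End Weights.

(** * Power sums and the product over the branches *)

Section Comparison.
Variables (R : comNzRingType) (z : nat -> R).
Hypothesis tfR : torsion_free R.
Local Open Scope ring_scope.

Lemma lreg_polyXnMn n N : (0 < N)%N -> GRing.lreg ('X^n *+ N : {poly R}).
Proof.
move=> N0 f g /eqP; rewrite -subr_eq0 -mulrBr mulrnAl => /eqP fg.
have {}fg := torsion_free_poly tfR N0 fg; apply/eqP; rewrite -subr_eq0; apply/eqP.
apply/polyP => i; rewrite coef0; have /polyP/(_ (n + i)%N) := fg.
by rewrite coefXnM coef0 ltnNge leq_addr addKn.
Qed.

Variables (al l : nat) (p p' : seq nat).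
Hypotheses (pal : all (leq^~ al) p) (pal' : all (leq^~ al) p').
Hypothesis size_pp' : size p = size p'.
Hypothesis psum1_pp' : psum 1 p = psum 1 p'.
Hypothesis psum_pp' : forall i, (i < l)%N -> psum i p = psum i p'.

Let Pr p := \prod_(a <- p) branch z al a.
Let c := clearing z al.
Let F := \prod_(a <- p) bunch z al a.

Lemma sum_detach s j : all (leq^~ al) s ->
  \sum_(x <- map (detach z al) s) x ^+ j
    = \sum_(a <- s) (detach_poly z al ^+ j).['X *+ a].
Proof.
elim: s => [|a s IH] /=; first by rewrite !big_nil.
by case/andP=> aal sal; rewrite !big_cons IH // detachE // horner_exp.
Qed.

Let T s := \sum_(x <- map (detach z al) s) x.

Lemma sum_detach1 s : all (leq^~ al) s ->
  T s = \sum_(a <- s) (detach_poly z al).['X *+ a].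
Proof. by move=> sal; have := sum_detach 1 sal; rewrite expr1. Qed.

Lemma eqm_T : eqm l (T p) (T p').
Proof. by rewrite !sum_detach1 //; apply: eqm_sum_horner. Qed.

(** The open bunches contribute the same factor [F] on both sides, so that it
remains to compare the elementary symmetric functions of the [detach al a];
modulo ['X^(l + 2)] only the one of degree one can make a difference. *)
Lemma eqm_clear_prod_branch :
  eqm l.+2 (c ^+ size p * (Pr p - Pr p'))
           (F * c ^+ (size p).-1 * 'X * (T p - T p')).
Proof.
have prE' : c ^+ size p * Pr p' = F * \prod_(x <- map (detach z al) p') (c + 'X * x).
  rewrite size_pp' clear_prod_branch //; congr (_ * _).
  by rewrite /F !prod_bunch // size_pp' psum1_pp'.
rewrite mulrBr prE' clear_prod_branch // -mulrBr -/F -!mulrA; apply: eqmM => //.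
have sizes : size (map (detach z al) p) = size (map (detach z al) p').
  by rewrite !size_map.
have sums j : eqm l (\sum_(x <- map (detach z al) p) x ^+ j.+1)
                    (\sum_(x <- map (detach z al) p') x ^+ j.+1).
  by rewrite !sum_detach //; apply: eqm_sum_horner.
have := eqm_prod_elsym (torsion_free_poly tfR) c sizes sums; rewrite size_map -/(T p) -/(T p').
set u := \prod_(x <- _) _; set u' := \prod_(x <- map _ p') _; set d := c ^+ _.
move=> uu'; have := eqmD uu' (@eqm_refl _ _ (d * ('X * T p) - u')).
have -> : u - d * ('X * T p) + (d * ('X * T p) - u') = u - u' by ring.
by have -> : u' - d * ('X * T p') + (d * ('X * T p) - u')
  = d * ('X * (T p - T p')) by ring.
Qed.

Lemma lreg_clearing n : GRing.lreg (c ^+ n)`_0.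
Proof.
rewrite coef0X; apply: lregX; rewrite coef0_clearing; apply: lreg_polyXnMn.
by rewrite muln_gt0 fact_gt0.
Qed.

Lemma eqm_prod_branch : eqm l.+1 (Pr p) (Pr p').
Proof.
apply: (@eqm_mulI _ l.+1 (c ^+ size p)); first exact: lreg_clearing.
move=> i il; apply/eqP.
rewrite -subr_eq0 -coefB -mulrBr (eqm_clear_prod_branch (ltnW il)); apply/eqP.
have := @eqm_XnM _ _ 1 _ _ (eqmM (@eqm_refl _ l (F * c ^+ (size p).-1)) eqm_T).
rewrite add1n expr1 => /(_ i il)/eqP; rewrite -subr_eq0 -coefB => /eqP E.
by rewrite -[RHS]E; congr ((polyseq _)`_i); ring.
Qed.

(** In the first degree where the two products can differ, the difference is the
leading coefficient of [detach_poly] times that of the power sums. *)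
Lemma coef_prod_branch : (0 < size p)%N ->
  ((Pr p)`_l.+1 - (Pr p')`_l.+1) * ('X^(6 * al + 1) *+ (al`! * al`!))
    = 'X^((3 * al + 1) * size p) *
      ((detach_poly z al)`_l`_0 *+ psum l p - (detach_poly z al)`_l`_0 *+ psum l p').
Proof.
move=> p0.
have := eqm_clear_prod_branch (ltnSn l.+1).
rewrite coefM_lowest => [|i il]; last by rewrite coefB eqm_prod_branch ?subrr.
rewrite -mulrA mulrCA coefXM /= coefM_lowest => [|i il]; last first.
  by rewrite coefB eqm_T ?subrr.
rewrite !coefB !sum_detach1 // coef_sum_horner // !coef0M.
have -> : F`_0 = 'X^((3 * al + 1) * size p).
  rewrite /F coef0_prod; elim: p pal => [|a s IH]; first by rewrite big_nil muln0.
  by case/andP=> aal sal; rewrite big_cons (IH sal) coef0_bunch // -exprD -mulnS.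
rewrite -(coef0_clearing z) -/c => E; move: (@lreg_clearing (size p).-1) => reg.
apply: reg; rewrite mulrCA mulrA -[in LHS]mulrA -coef0M -exprSr prednK //.
by rewrite mulrC E; ring.
Qed.

(** [coef_prod_branch] with the common powers of the size marker cancelled, which
is possible because there are at least two bunches. *)
Lemma zlin_prod_branch : (1 < size p)%N ->
  (zlin z (yvar R * Pr p)`_l.+1 - zlin z (yvar R * Pr p')`_l.+1) *+ (al`! * al`!)
    = zlin z ('X^((3 * al + 1) * (size p - 2) + 2) * (detach_poly z al)`_l`_0)
        *+ psum l p
      - zlin z ('X^((3 * al + 1) * (size p - 2) + 2) * (detach_poly z al)`_l`_0)
        *+ psum l p'.
Proof.
move=> p1; have := coef_prod_branch (ltnW p1).
set dp := (detach_poly _ _)`_l`_0; set E := (3 * al + 1)%N.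
set u := (Pr p)`_l.+1; set u' := (Pr p')`_l.+1; set N := (al`! * al`!)%N => eq1.
have eq2 : (u - u') *+ N = 'X^(E * (size p - 2) + 1) * (dp *+ psum l p - dp *+ psum l p').
  apply: (@lreg_polyXnMn (6 * al + 1) 1) => //.
  rewrite mulr1n mulrA -exprD mulrnAr mulrC -mulrnAr eq1; congr ('X^_ * _).
  by rewrite -{1}(subnK p1) mulnDr; set w := (E * _)%N; rewrite /E; lia.
rewrite !coefCM -raddfB -!raddfMn -raddfB /= -mulrBr; congr (zlin z _).
by rewrite -!mulrnAr -mulrBr -/u -/u' eq2 mulrA -exprS -addnS.
Qed.

End Comparison.

(** * Explicit coefficients *)

Section Coefficients.
Variables (R : comNzRingType) (z : nat -> R).
Local Open Scope ring_scope.

Lemma coef1_star_copy : (star_copy z)`_1 = (z 1)%:P * 'X^2 *+ 2 + (z 3)%:P.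
Proof.
rewrite /star_copy /yvar /zconst -polyC_exp !coefD coefC /= coefXM !coefXnM /= add0r !addr0.
by rewrite coefD coefMn coef0M -polyC_exp !coefC.
Qed.

Lemma coef1_bunch al a : z 1 = 0 -> (0 < al)%N -> (a <= al)%N ->
  (bunch z al a)`_1 = (z 3)%:P * 'X^(3 * al - 2) *+ al
                      + (z 2)%:P * 'X^(3 * al - 1) *+ a.
Proof.
case: al => // m z1 _ aal; rewrite bunchE // /binom_sum coef_sum.
rewrite !big_ord_recl big1 /= => [|j _]; last first.
  by rewrite coefMn coefXnM mul0rn.
rewrite addr0 !coefMn !coefXnM /= /bump /= bin0 bin1 mulr1n /bunch_coef.
rewrite expr0 mulr1 subn0 subSS subn0 expr1 !coefCM !coef0M coef0X coef0_star_copy.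
have -> : (star_copy z ^+ m.+1)`_1 = (z 3)%:P * 'X^(3 * m) *+ m.+1.
  have := @coef1_prod _ 'X^3 (nseq m.+1 (star_copy z)).
  rewrite all_nseq coef0_star_copy eqxx orbT => /(_ isT).
  rewrite !big_nseq !iter_mulr !iter_addr size_nseq mulr1 addr0 => ->.
  by rewrite coef1_star_copy z1 polyC0 mul0r mul0rn add0r -exprM.
have -> : (yvar R)`_0 * (copy_diff z)`_0 * 'X^3 ^+ (m - 0) = (z 2)%:P * 'X^(3 * m + 2).
  rewrite /copy_diff coefB !coefCM !coefC /= z1 polyC0 mul0r subr0.
  by rewrite subn0 -exprM addn2 !exprS; ring.
have -> : (3 * m.+1 - 2 = (3 * m).+1)%N by lia.
have -> : (3 * m.+1 - 1 = 3 * m + 2)%N by lia.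
by rewrite mulrnAr exprS mulrCA.
Qed.

(** The cut polynomial of [T_ al p], rooted at its centre. *)
Definition PTE_cut_poly al p : {poly {poly R}} :=
  yvar R * \prod_(a <- p) branch z al a.

Lemma coef0_branch al a : (a <= al)%N -> (branch z al a)`_0 = 'X^(3 * al + 1).
Proof. by move=> aal; rewrite /branch coefD coefXM addr0 coef0_bunch. Qed.

Lemma coef0_prod_branch al p : all (leq^~ al) p ->
  (\prod_(a <- p) branch z al a)`_0 = 'X^((3 * al + 1) * size p).
Proof.
rewrite coef0_prod; elim: p => [|a p IH] /=; first by rewrite big_nil muln0.
by case/andP=> aal pal; rewrite big_cons (IH pal) coef0_branch // -exprD -mulnS.
Qed.

Lemma zlin_PTE_cut_poly0 al p : all (leq^~ al) p ->
  zlin z (PTE_cut_poly al p)`_0 = z ((3 * al + 1) * size p + 1).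
Proof.
move=> pal; rewrite /PTE_cut_poly coefCM coef0_prod_branch //.
by rewrite -exprS zlinXn; congr z; rewrite [RHS]addn1.
Qed.

(** One cut separates three vertices in every copy, two vertices in every path
copy, a whole bunch, or a leaf; the leaves are suppressed by [z 1 = 0]. *)
Lemma zlin_PTE_cut_poly1 al p : z 1 = 0 -> (0 < al)%N -> all (leq^~ al) p ->
  let N := ((3 * al + 1) * size p + 1)%N in
  zlin z (PTE_cut_poly al p)`_1
    = z 3 * z (N - 3) *+ (size p * al) + z 2 * z (N - 2) *+ psum 1 p
      + z (3 * al + 1) * z (N - (3 * al + 1)) *+ size p.
Proof.
move=> z1 al0 pal N; rewrite coefCM.
have := @coef1_prod _ 'X^(3 * al + 1) (map (branch z al) p).
rewrite all_map (eq_in_all (a2 := xpredT)) ?all_predT => [/(_ isT)|a ap /=]; last first.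
  by rewrite coef0_branch ?eqxx //; move/allP: pal; apply.
rewrite !big_map size_map => ->; rewrite mulr_sumr raddf_sum /=.
pose t a := z 3 * z (N - 3) *+ al + z 2 * z (N - 2) *+ a
            + z (3 * al + 1) * z (N - (3 * al + 1)).
rewrite (eq_big_seq t) => [|a ap].
  rewrite !big_split /= !big_const_seq !count_predT !iter_addr !addr0.
  by rewrite sumrMnr -mulrnA mulnC.
have aal : (a <= al)%N by move/allP: pal; apply.
have p0 : (0 < size p)%N by case: p ap {pal N t}.
have pE : ((3 * al + 1) * size p = (3 * al + 1) + (3 * al + 1) * (size p).-1)%N.
  by rewrite -mulnS prednK.
rewrite /branch coefD coefXM /= coef_close_root coef0_bunch // coef1_bunch // zlinXn.
rewrite -exprM /t; move: pE; rewrite /N; set w := (_ * (size p).-1)%N => ->.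
rewrite (_ : 'X * _ = z 3 *: 'X^((3 * al - 2 + w).+1) *+ al
    + z 2 *: 'X^((3 * al - 1 + w).+1) *+ a + z (3 * al + 1) *: 'X^(w.+1)); last first.
  by rewrite -!mul_polyC !exprS !exprD; ring.
rewrite !raddfD /= !raddfMn /= !linearZ /= !zlinXn.
by congr (_ * z _ *+ _ + _ * z _ *+ _ + _ * z _); lia.
Qed.

(** With these values of [z] the difference [copy_diff] becomes the size marker,
and all factors of the leading coefficient are monomials. *)
Lemma zlin_detach_poly al l e : z 1 = 0 -> z 2 = 1 -> (l <= al)%N ->
  zlin z ('X^e * (detach_poly z al)`_l`_0)
   = \sum_(i < l.+1) ((-1) ^+ i * z (e + 3 * al - 2 * i) * z (3 * al + 1 - 2 * (l - i)))
       *+ ((al ^_ (al - i)) * (al ^_ (al - (l - i)))).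
Proof.
move=> z1 z2 lal; rewrite coefM coef_sum mulr_sumr raddf_sum.
have diffE : copy_diff z = yvar R.
  by rewrite /copy_diff /zconst z1 z2 polyC1 !polyC0 mul0r subr0 mul1r.
apply: eq_bigr => i _ /=.
have il : (i <= l)%N by rewrite -ltnS.
have [ial lial] : (i <= al)%N /\ (l - i <= al)%N by lia.
rewrite coef0M !coef0_binom_poly // coef_close_root /bunch_coef /cobunch_coef.
rewrite diffE !coef0M !coef0X coef0_star_copy coef0_path_copy coefN coefC /=.
rewrite -exprS -!exprM -exprD zlinXn; set c := z _; set m := (_ ^_ _); set m' := (_ ^_ _).
rewrite (_ : 'X^e * _ = ((-1) ^+ i * c) *: 'X^(e + i + 3 * (al - i)) *+ (m * m')).
  rewrite raddfMn /= linearZ /= zlinXn mulrAC; congr (_ * z _ * z _ *+ _); lia.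
rewrite -mul_polyC polyCM polyC_exp polyCN polyC1 !exprD exprNn mulrnA.
rewrite !(mulrnAl, mulrnAr) [LHS]mulrnAC; congr (_ *+ _ *+ _); ring.
Qed.

End Coefficients.

(** * Cutting rooted trees *)

(** Rooted trees on [V], given by parents; the value [parent apex] is junk. The
depth makes the parent relation well-founded. *)
Record rooting (V : finType) := Rooting {
  apex : V;
  parent : V -> V;
  depth : V -> nat;
  depth_apex : depth apex = 0;
  depth_parent : forall u, u != apex -> depth u = (depth (parent u)).+1 }.

Section Rooting.
Variables (V : finType) (rt : rooting V).
Local Notation r := (apex rt).
Local Notation par := (parent rt).
Local Notation h := (depth rt).
Implicit Types (u v w : V) (D X : {set V}).

Lemma parent_ind (P : V -> Prop) :
  (forall u, (u != r -> P (par u)) -> P u) -> forall u, P u.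
Proof.
move=> IH u; move: {2}(h u) (erefl (h u)) => n; elim: n u => [|n IHn] u hu.
  by apply: IH => /depth_parent; rewrite hu.
by apply: IH => ur; apply: IHn; apply: succn_inj; rewrite -depth_parent.
Qed.

Definition desc v :=
  [set u | (h v <= h u) && (iter (h u - h v) par u == v)].

Lemma in_desc v u : (u \in desc v) = (u == v) || (u != r) && (par u \in desc v).
Proof.
rewrite !inE; have [->|ur] /= := eqVneq u r.
  rewrite depth_apex leqn0 sub0n orbF /= andbC.
  by have [<-|] := eqVneq r v; rewrite ?depth_apex ?andbF.
rewrite (depth_parent ur) leq_eqVlt andb_orl ltnS; congr (_ || _).
  have [<-|uv] := eqVneq u v; first by rewrite -(depth_parent ur) eqxx subnn /= eqxx.
  by case: eqP => // ->; rewrite subnn /= (negbTE uv).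
by case: leqP => //= vu; rewrite subSn // iterSr.
Qed.

Lemma desc_self v : v \in desc v. Proof. by rewrite in_desc eqxx. Qed.

Lemma desc_apex : desc r = [set: V].
Proof.
apply/setP => u; rewrite in_setT; elim/parent_ind: u => u IH.
by rewrite in_desc; case: eqVneq => //= /IH.
Qed.

Definition child v : pred V := [pred c | (c != r) && (par c == v)].

Lemma depth_child v c : child v c -> h c = (h v).+1.
Proof. by case/andP=> cr /eqP <-; apply: depth_parent. Qed.

Lemma child_notin_desc v c : child v c -> v \notin desc c.
Proof. by move=> /depth_child hc; rewrite inE hc ltnn. Qed.

Lemma desc_child_disjoint v c c' : child v c -> child v c' -> c != c' ->
  [disjoint desc c & desc c'].
Proof.
move=> vc vc'; apply: contraR => /pred0Pn[u /andP[]]; rewrite !inE.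
rewrite (depth_child vc) (depth_child vc') => /andP[_ /eqP uc] /andP[_ /eqP uc'].
by rewrite -uc -uc'.
Qed.

Lemma desc_children v :
  desc v = v |: \bigcup_(c | child v c) desc c.
Proof.
apply/setP; elim/parent_ind => u IH; rewrite in_desc in_setU1; case: eqVneq => //= uv.
have [->|ur] /= := eqVneq u r.
  apply/esym/bigcupP => -[c /andP[cr _]].
  by rewrite in_desc eqxx orbF eq_sym (negbTE cr).
rewrite (IH ur) in_setU1; apply/idP/bigcupP => [/predU1P[uE|/bigcupP[c vc uc]]|[c vc]].
- by exists u; [apply/andP; split; last exact/eqP | apply: desc_self].
- by exists c; rewrite // in_desc ur uc orbT.
rewrite in_desc ur /= => /predU1P[uc|uc].
  by case/andP: vc => _ /eqP pc; rewrite uc pc eqxx.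
by apply/orP; right; apply/bigcupP; exists c.
Qed.

(** The set of cuts is encoded by the set [D] of the topmost vertices of the
components: each of them has lost the edge to its parent, except for the topmost
vertex of the whole tree. *)
Definition top D u := iter (h u) (fun w => if w \in D then w else par w) u.

Lemma top_in D u : u \in D -> top D u = u.
Proof. by move=> uD; rewrite /top; elim: (h u) => //= n ->; rewrite uD. Qed.

Lemma top_notin D u : u != r -> u \notin D -> top D u = top D (par u).
Proof. by move=> ur uD; rewrite /top (depth_parent ur) iterSr (negbTE uD). Qed.

(** Subtrees rooted at [v] that need not contain all descendants of [v]; they
appear when the children of [v] are added one after the other. *)
Definition subtree v X :=
  v \in X /\ forall u, u \in X -> u != v -> u != r /\ par u \in X.

Lemma subtree_top v X D u : subtree v X -> v \in D -> u \in X ->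
  top D u \in D :&: X.
Proof.
move=> [vX subX] vD; elim/parent_ind: u => u IH uX.
have [uD|uD] := boolP (u \in D); first by rewrite top_in // inE uD.
have uv : u != v by apply: contraNneq uD => ->.
by have [ur pX] := subX u uX uv; rewrite top_notin // IH.
Qed.

Lemma eq_top v X D D' u : subtree v X -> v \in D -> D :&: X = D' :&: X ->
  u \in X -> top D u = top D' u.
Proof.
move=> [vX subX] vD /setP DD'; elim/parent_ind: u => u IH uX.
have := DD' u; rewrite !inE uX !andbT => uDD'.
have [uD|uD] := boolP (u \in D); first by rewrite !top_in -?uDD'.
have uv : u != v by apply: contraNneq uD => ->.
have [ur pX] := subX u uX uv; rewrite (top_notin ur uD) IH // [RHS]top_notin //.
by rewrite -uDD'.
Qed.

Definition block X D d := #|[set u in X | top D u == d]|.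

Lemma blockU X X' D d : [disjoint X & X'] ->
  block (X :|: X') D d = block X D d + block X' D d.
Proof.
move=> XX'; rewrite /block; set S := [set u in X | _]; set S' := [set u in X' | _].
have -> : [set u in X :|: X' | top D u == d] = S :|: S'.
  by apply/setP => u; rewrite !inE andb_orl.
rewrite cardsU disjoint_setI0 ?cards0 ?subn0 //.
apply: disjointWl (disjointWr _ XX'); by apply/subsetP => u; rewrite inE => /andP[].
Qed.

Lemma eq_block v X D D' d : subtree v X -> v \in D -> D :&: X = D' :&: X ->
  block X D d = block X D' d.
Proof.
move=> vX vD DD'; apply: eq_card => u; rewrite !inE.
by case: (boolP (u \in X)) => //= uX; rewrite (eq_top vX vD DD' uX).
Qed.

Lemma block0 v X D d : subtree v X -> v \in D -> d \notin X -> block X D d = 0.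
Proof.
move=> vX vD dX; apply: eq_card0 => u; rewrite !inE; apply/andP => -[uX /eqP ud].
by have := subtree_top vX vD uX; rewrite ud inE (negbTE dX) andbF.
Qed.

Section CutSum.
Variables (R : comNzRingType) (z : nat -> R).
Local Open Scope ring_scope.

(** Here [v] is the root of [X], so the first factor counts the cuts, and the
component of [v] is left open. *)
Definition cut_term v X D : {poly {poly R}} :=
  'X^(#|D|.-1) * yvar R ^+ block X D v * \prod_(d in D :\ v) zconst z (block X D d).

Definition cut_sum v X : {poly {poly R}} :=
  \sum_(D : {set V} | (D \subset X) && (v \in D)) cut_term v X D.

Definition closed_term X D : {poly {poly R}} :=
  'X^(#|D|.-1) * \prod_(d in D) zconst z (block X D d).

Lemma close_root_yX n f c :
  close_root z ('X^n * f%:P * c%:P%:P) = 'X^n * (zlin z f)%:P%:P * c%:P%:P.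
Proof.
by rewrite -mulrA close_rootXn [f%:P * _]mulrC close_rootC close_root_polyC; ring.
Qed.

Lemma close_cut_term v X D : v \in D ->
  close_root z (cut_term v X D) = closed_term X D.
Proof.
move=> vD; pose c := \prod_(d in D :\ v) z (block X D d).
have cE : \prod_(d in D :\ v) zconst z (block X D d) = c%:P%:P.
  by rewrite /c !rmorph_prod.
rewrite /cut_term /closed_term (big_setD1 v vD) /= cE /yvar -polyC_exp.
by rewrite close_root_yX zlinXn mulrA.
Qed.

Lemma close_cut_sum v X :
  close_root z (cut_sum v X)
    = \sum_(D : {set V} | (D \subset X) && (v \in D)) closed_term X D.
Proof.
by rewrite /cut_sum raddf_sum; apply: eq_bigr => D /andP[_ vD]; apply: close_cut_term.
Qed.

Lemma prod_setU (B : comNzRingType) (D D' : {set V}) (F : V -> B) :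
  [disjoint D & D'] ->
  \prod_(d in D :|: D') F d = \prod_(d in D) F d * \prod_(d in D') F d.
Proof. by move=> disj; rewrite -bigU //; apply: eq_bigl => d; rewrite !inE. Qed.

(** Grafting a subtree [X'] with root [w] onto the vertex [v]. *)

Section Join.
Variables (v w : V) (X X' : {set V}).
Hypotheses (vX : subtree v X) (wX' : subtree w X').
Hypotheses (disj : [disjoint X & X']) (vw : child v w).

Let wr : w != r. Proof. by case/andP: vw. Qed.
Let pw : par w = v. Proof. by case/andP: vw => _ /eqP. Qed.

Lemma subtree_join : subtree v (X :|: X').
Proof.
have [[vX0 subX] [wX0 subX']] := (vX, wX').
split=> [|u]; first by rewrite inE vX0.
rewrite !inE => /orP[uX uv|uX' _].
  by have [ur pX] := subX u uX uv; rewrite pX.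
have [->|uw] := eqVneq u w; first by rewrite wr pw vX0.
by have [ur pX] := subX' u uX' uw; rewrite pX orbT.
Qed.

Let notinX d : d \in X' -> d \notin X.
Proof. by move=> dX'; apply/negP => dX; have /pred0P/(_ d) := disj; rewrite /= dX dX'. Qed.
Let notinX' d : d \in X -> d \notin X'.
Proof. by apply: contraL; apply: notinX. Qed.

Let setI_disj D D' : D \subset X -> D' \subset X' ->
  ((D :|: D') :&: X = D) /\ ((D :|: D') :&: X' = D').
Proof.
move=> /subsetP DX /subsetP DX'; split; apply/setP => d; rewrite !inE.
  have [/DX ->|_] := boolP (d \in D); first by [].
  by apply/andP => -[/DX'/notinX/negP].
have [/DX'->|_] := boolP (d \in D'); first by rewrite orbT.
by rewrite orbF; apply/andP => -[/DX/notinX'/negP].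
Qed.

Section Terms.
Variables (D D' : {set V}).
Hypotheses (DX : D \subset X) (vD : v \in D) (DX' : D' \subset X') (wD' : w \in D').

Let disjD : [disjoint D & D'].
Proof. exact: disjointWl DX (disjointWr DX' disj). Qed.

(** If the edge between [v] and [w] is cut, then no component meets both [X] and
[X']. *)
Lemma cut_term_join :
  cut_term v (X :|: X') (D :|: D') = cut_term v X D * ('X * closed_term X' D').
Proof.
have [IX IX'] := setI_disj DX DX'.
have IXE : (D :|: D') :&: X = D :&: X by rewrite IX (setIidPl DX).
have IXE' : (D :|: D') :&: X' = D' :&: X' by rewrite IX' (setIidPl DX').
have vU : v \in D :|: D' by rewrite inE vD.
have wU : w \in D :|: D' by rewrite inE wD' orbT.
have bX d : d \in X -> block (X :|: X') (D :|: D') d = block X D d.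
  move=> dX; rewrite blockU // (block0 wX' wU (notinX' dX)) addn0.
  exact: (eq_block _ vX vU).
have bX' d : d \in X' -> block (X :|: X') (D :|: D') d = block X' D' d.
  move=> dX; rewrite blockU // (block0 vX vU (notinX dX)) add0n.
  exact: (eq_block _ wX' wU).
have vX0 : v \in X by apply: (subsetP DX).
rewrite /cut_term /closed_term bX //.
have -> : #|D :|: D'|.-1 = (#|D|.-1 + (#|D'|.-1).+1)%N.
  rewrite cardsU disjoint_setI0 // cards0 subn0.
  by rewrite prednK; [rewrite -subn1 -addnBAC ?subn1 // | ]; apply/card_gt0P; eexists; eassumption.
have -> : (D :|: D') :\ v = (D :\ v) :|: D'.
  apply/setP => d; rewrite !inE; case: eqVneq => //= ->; apply/esym/negbTE.
  by apply: contra (notinX' vX0); apply: (subsetP DX').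
rewrite prod_setU; last by apply: disjointWl (subsetDl _ _) disjD.
under eq_bigr => d /setD1P[_ /(subsetP DX) dX] do rewrite bX //.
under [X in _ * (_ * X) = _]eq_bigr => d /(subsetP DX') dX' do rewrite bX' //.
by rewrite exprD exprS; ring.
Qed.

(** If the edge between [v] and [w] is kept, then [w] is no longer topmost and
its component in [X'] is added to that of [v]. *)
Lemma cut_term_graft :
  cut_term v (X :|: X') (D :|: (D' :\ w)) = cut_term v X D * cut_term w X' D'.
Proof.
set U := D :|: (D' :\ w).
have DwX' : D' :\ w \subset X' by apply: subset_trans (subsetDl _ _) DX'.
have [IX IX'] := setI_disj DX DwX'; rewrite -/U in IX IX'.
have vX0 : v \in X by apply: (subsetP DX).
have IXE : U :&: X = D :&: X by rewrite IX (setIidPl DX).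
have vU : v \in U by rewrite inE vD.
have wU : w \notin U.
  by rewrite !inE eqxx orbF; apply: contraL (subsetP DX' w wD') => /(subsetP DX)/notinX'.
have topX' u : u \in X' -> top U u = if top D' u == w then v else top D' u.
  elim/parent_ind: u => u IH uX'; have [uU|uU] := boolP (u \in U).
    have /setD1P[/negbTE uw uD'] : u \in D' :\ w by rewrite -IX' inE uU uX'.
    by rewrite !top_in // uw.
  have [->|uw] := eqVneq u w.
    by rewrite (top_notin wr wU) pw (top_in wD') eqxx top_in.
  have uD' : u \notin D' by apply: contra uU => uD'; rewrite !inE uw uD' orbT.
  have [_ /(_ u uX' uw)[ur pX']] := wX'.
  by rewrite (top_notin ur uU) (top_notin ur uD') IH.
have bX d : d \in X -> block (X :|: X') U d = (block X D d + (d == v) * block X' D' w)%N.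
  move=> dX; rewrite blockU // (eq_block _ vX vU IXE); congr (_ + _)%N.
  have [->|dv] := eqVneq d v; rewrite /= ?mul1n ?mul0n; last first.
    apply: eq_card0 => u; rewrite !inE; apply/andP => -[uX' /eqP].
    rewrite topX' //; have [_ vd|_ ud] := eqVneq (top D' u) w; first by rewrite vd eqxx in dv.
    have := subtree_top wX' wD' uX'; rewrite ud inE => /andP[_ /notinX].
    by rewrite dX.
  apply: eq_card => u; rewrite !inE; case: (boolP (u \in X')) => //= uX'.
  rewrite topX' //; have [_|_] := eqVneq (top D' u) w; first by rewrite eqxx.
  apply/negbTE/eqP => uv; have := subtree_top wX' wD' uX'.
  by rewrite uv inE => /andP[_ /notinX]; rewrite vX0.
have bX' d : d \in X' -> d != w -> block (X :|: X') U d = block X' D' d.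
  move=> dX' dw; rewrite blockU // (block0 vX vU (notinX dX')) add0n.
  apply: eq_card => u; rewrite !inE; case: (boolP (u \in X')) => //= uX'.
  rewrite topX' //; have [->|//] := eqVneq (top D' u) w.
  rewrite eq_sym [w == d]eq_sym (negbTE dw).
  by apply/negbTE; apply: contraTneq dX' => ->; apply: notinX'.
rewrite /cut_term bX // eqxx mul1n.
have disjDw : [disjoint D & D' :\ w] by apply: disjointWr (subsetDl _ _) disjD.
have -> : #|U|.-1 = (#|D|.-1 + #|D'|.-1)%N.
  rewrite cardsU disjoint_setI0 // cards0 subn0 [in RHS](cardsD1 w D') wD' /=.
  by rewrite (cardsD1 v D) vD.
have -> : U :\ v = (D :\ v) :|: (D' :\ w).
  apply/setP => d; rewrite !inE; case: eqVneq => //= ->; apply/esym/negbTE.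
  by apply: contra (notinX' vX0) => /andP[_]; apply: (subsetP DX').
rewrite prod_setU; last by apply: disjointWl (subsetDl _ _) disjDw.
under eq_bigr => d /setD1P[dv /(subsetP DX) dX].
  rewrite bX // (negbTE dv) mul0n addn0; over.
under [X in _ * (_ * X) = _]eq_bigr => d /setD1P[dw /(subsetP DX') dX'].
  rewrite bX' //; over.
by rewrite !exprD; ring.
Qed.

End Terms.

(** The sets [D] for [X :|: X'] correspond to pairs of such sets for [X] and [X']
together with the decision to cut the edge between [v] and [w]. *)
Lemma cut_sum_join :
  cut_sum v (X :|: X')
    = cut_sum v X * (cut_sum w X' + 'X * close_root z (cut_sum w X')).
Proof.
rewrite close_cut_sum [LHS](bigID (fun D : {set V} => w \in D)) /= addrC mulrDr.
have [vX0 wX0] : v \in X /\ w \in X' by split; [case: vX | case: wX'].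
congr (_ + _); last first.
  rewrite big_distrr big_distrlr /= pair_big_dep /=.
  rewrite (reindex_onto (fun P : {set V} * {set V} => P.1 :|: P.2)
                        (fun D => (D :&: X, D :&: X'))) /=; last first.
    by move=> D /andP[/andP[DXX' _] _]; rewrite -setIUr (setIidPl DXX').
  rewrite (eq_bigl (fun P : {set V} * {set V} =>
    ((P.1 \subset X) && (v \in P.1)) && ((P.2 \subset X') && (w \in P.2)))).
    apply: eq_bigr => -[D D'] /andP[/andP[DX vD] /andP[DX' wD']].
    exact: cut_term_join.
  move=> [D D'] /=; apply/idP/idP.
    case/andP=> /andP[/andP[_ vD] wD] /eqP[DE DE'].
    have vD0 : v \in D by rewrite -DE in_setI vD.
    have wD0 : w \in D' by rewrite -DE' in_setI wD.
    by rewrite vD0 wD0 -DE -DE' !subsetIr.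
  case/andP=> /andP[DX vD] /andP[DX' wD']; have [-> ->] := setI_disj DX DX'.
  by rewrite eqxx setUSS // !in_setU vD wD' orbT.
rewrite big_distrlr /= pair_big_dep /=.
rewrite (reindex_onto (fun P : {set V} * {set V} => P.1 :|: (P.2 :\ w))
                      (fun D => (D :&: X, w |: (D :&: X')))) /=; last first.
  move=> D /andP[/andP[DXX' _] wD]; rewrite setU1K; last by rewrite inE (negbTE wD).
  by rewrite -setIUr (setIidPl DXX').
rewrite (eq_bigl (fun P : {set V} * {set V} =>
  ((P.1 \subset X) && (v \in P.1)) && ((P.2 \subset X') && (w \in P.2)))).
  apply: eq_bigr => -[D D'] /andP[/andP[DX vD] /andP[DX' wD']].
  exact: cut_term_graft.
move=> [D D'] /=; apply/idP/idP.
  case/andP=> /andP[/andP[_ vD] wD] /eqP[DE DE'].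
  have vD0 : v \in D by rewrite -DE in_setI vD.
  have wD0 : w \in D' by rewrite -DE' setU11.
  by rewrite vD0 wD0 -DE -DE' subUset sub1set !subsetIr wX0.
case/andP=> /andP[DX vD] /andP[DX' wD'].
have DwX' : D' :\ w \subset X' by apply: subset_trans (subsetDl _ _) DX'.
have [-> ->] := setI_disj DX DwX'; rewrite setD1K // eqxx setUSS // !inE vD eqxx /=.
by rewrite !andbT orbF; apply: contraL wX0 => /(subsetP DX)/notinX'.
Qed.

End Join.

Lemma subtree1 v : subtree v [set v].
Proof. by split=> [|u]; rewrite inE // => ->. Qed.

Lemma cut_sum1 v : cut_sum v [set v] = yvar R.
Proof.
rewrite /cut_sum (big_pred1 [set v]) => [|D]; last first.
  by rewrite /= eqEsubset sub1set.
rewrite /cut_term cards1 setDv big_set0 mulr1 mul1r /block.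
rewrite (_ : [set u in _ | _] = [set v]) ?cards1 ?expr1 //.
by apply/setP => u; rewrite !inE; case: eqP => //= ->; rewrite top_in ?inE ?eqxx.
Qed.

Lemma subtree_desc v : subtree v (desc v).
Proof.
split=> [|u]; first exact: desc_self.
by rewrite in_desc => /orP[/eqP->|/andP[ur pu]]; rewrite ?eqxx.
Qed.

Definition desc_sum v := cut_sum v (desc v).

(** Grafting the subtrees of the children of [v] one by one onto the single
vertex [v]. *)
Lemma desc_sum_children v :
  desc_sum v = yvar R * \prod_(c | child v c)
                          (desc_sum c + 'X * close_root z (desc_sum c)).
Proof.
rewrite /desc_sum desc_children.
rewrite -[in LHS]big_filter -[in RHS]big_filter.
set s := filter _ _; have : all (child v) s by apply: filter_all.
have : uniq s by rewrite filter_uniq // index_enum_uniq.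
suff: uniq s -> all (child v) s -> subtree v (v |: \bigcup_(c <- s) desc c) /\
    cut_sum v (v |: \bigcup_(c <- s) desc c) = yvar R * \prod_(c <- s)
      (desc_sum c + 'X * close_root z (desc_sum c)).
  by move=> H us vs; have [] := H us vs.
elim: s => [|c s IH] /=.
  by rewrite !big_nil setU0 cut_sum1 mulr1; split=> //; apply: subtree1.
case/andP=> cs us /andP[vc vs]; have [st_s sum_s] := IH us vs.
rewrite !big_cons [desc c :|: _]setUC setUA.
have disj : [disjoint v |: \bigcup_(c <- s) desc c & desc c].
  rewrite -setI_eq0 setIUl setU_eq0 !setI_eq0 disjoints1 child_notin_desc //=.
  rewrite disjoint_sym bigcup_seq.
  apply/bigcup_disjointP => c' c's.
  apply: (desc_child_disjoint vc (allP vs c' c's)).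
  by apply: contraNneq cs => ->.
split; first exact: subtree_join st_s (subtree_desc c) vc.
by rewrite (cut_sum_join st_s (subtree_desc c) disj vc) sum_s mulrAC -mulrA.
Qed.

End CutSum.
End Rooting.

(** * The polynomial of a graph with a rooting *)

Section RootedGraph.
Variables (G : sgraph) (rt : rooting G).
Local Notation r := (apex rt).
Local Notation par := (parent rt).

Definition tree_adj : rel G :=
  fun x y => (x != r) && (par x == y) || (y != r) && (par y == x).

Hypothesis adjE : @adj G =2 tree_adj.

Definition edge u : {set G} := [set u; par u].

Lemma par_neq u : u != r -> par u != u.
Proof.
by move=> ur; apply/eqP => pu; have := depth_parent ur; rewrite pu => /n_Sn.
Qed.

(** Two vertices with the same edge would be parents of each other, against the
depths. *)
Lemma edge_inj : {in ~: [set r] &, injective edge}.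
Proof.
move=> u w; rewrite !inE => ur wr uw.
have : u \in edge w by rewrite -uw set21.
rewrite !inE => /orP[/eqP //|/eqP up].
have : w \in edge u by rewrite uw set21.
rewrite !inE => /orP[/eqP //|/eqP wp].
by have := depth_parent ur; have := depth_parent wr; rewrite -up -wp; lia.
Qed.

Lemma edgesE : edges G = edge @: (~: [set r]).
Proof.
apply/setP => e; rewrite inE; apply/existsP/imsetP => [[x /existsP[y]]|[u]].
  rewrite adjE => /andP[/orP[]/andP[xr /eqP pE] /eqP ->].
    by exists x; rewrite ?inE // /edge pE.
  by exists y; rewrite ?inE // /edge pE setUC.
rewrite !inE => ur ->; exists u; apply/existsP; exists (par u).
by rewrite adjE /tree_adj ur !eqxx.
Qed.

Section Cut.
Variable D : {set G}.
Hypothesis rD : r \in D.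

Let A := edges G :\: edge @: (D :\ r).

Lemma keptE : A = edge @: (~: D).
Proof.
rewrite /A edgesE; apply/setP => e; rewrite inE; apply/andP/imsetP.
  move=> [eD /imsetP[u ur eu]]; exists u => //; rewrite inE; apply: contra eD => uD.
  by apply/imsetP; exists u => //; rewrite !inE in ur *; rewrite ur.
move=> [u]; rewrite inE => uD ->; have ur : u \in ~: [set r].
  by rewrite !inE; apply: contraNneq uD => ->.
split; last by apply/imsetP; exists u.
apply/imsetP => -[w]; rewrite !inE => /andP[wr wD] /edge_inj uw.
by move: uD; rewrite uw ?wD // !inE.
Qed.

Lemma span_adjE x y :
  span_adj A x y = (x \notin D) && (par x == y) || (y \notin D) && (par y == x).
Proof.
rewrite /span_adj /= keptE; apply/imsetP/orP => [[u]|].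
  rewrite inE => uD xyu; have xr : u != r by apply: contraNneq uD => ->.
  have : x \in edge u by rewrite -xyu set21.
  have : y \in edge u by rewrite -xyu set22.
  have : u \in [set x; y] by rewrite xyu set21.
  have : par u \in [set x; y] by rewrite xyu set22.
  rewrite !inE; have pu := par_neq xr.
  case: (eqVneq u x) => [<-|ux] /=.
    by rewrite (negbTE pu) /= => /eqP -> _ _ _; left; rewrite uD eqxx.
  move=> pxy /eqP uy _ _; right; rewrite -uy uD /=.
  by move: pxy; rewrite -uy (negbTE pu) orbF.
case=> /andP[xD /eqP pE]; first by exists x; rewrite ?inE // /edge pE.
by exists y; rewrite ?inE // /edge pE setUC.
Qed.

(** Every vertex is connected to its topmost vertex, and neighbours after the
cuts have the same one. *)
Lemma connect_top x y :
  connect (span_adj A) x y = (top rt D x == top rt D y).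
Proof.
have sym : connect_sym (span_adj A).
  by apply: sym_connect_sym => u w; rewrite /span_adj /= setUC.
have to_top u : connect (span_adj A) u (top rt D u).
  elim/(parent_ind (rt := rt)): u => u IH.
  have [uD|uD] := boolP (u \in D); first by rewrite top_in.
  have ur : u != r by apply: contraNneq uD => ->.
  rewrite top_notin //; apply: connect_trans (IH ur).
  by apply: connect1; rewrite span_adjE uD eqxx.
apply/idP/eqP => [|xy]; last first.
  by apply: connect_trans (to_top x) _; rewrite sym xy.
have step u w : u \notin D -> par u == w -> top rt D u = top rt D w.
  move=> uD /eqP <-; apply: top_notin => //.
  by apply: contraNneq uD => ->.
case/connectP => p + ->; elim: p x => //= w p IH x /andP[xw /IH <-].
by move: xw; rewrite span_adjE => /orP[]/andP[uD up]; rewrite (step _ _ uD up).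
Qed.

Lemma top_D u : top rt D u \in D.
Proof.
have sub : subtree rt r [set: G].
  by split=> [|w _ wr]; rewrite ?in_setT.
by have := subtree_top sub rD (in_setT u); rewrite inE => /andP[].
Qed.

Lemma componentsE :
  components A = (fun d => [set u | top rt D u == d]) @: D.
Proof.
apply/setP => C; rewrite /components /equivalence_partition.
apply/imsetP/imsetP => [[x _ ->]|[d dD ->]].
  exists (top rt D x); first exact: top_D.
  by apply/setP => u; rewrite !inE connect_top eq_sym.
by exists d => //; apply/setP => u; rewrite !inE connect_top eq_sym (top_in rt dD).
Qed.

Lemma x_part_lambda :
  x_part (lambda A) = (\prod_(d in D) x_ (block rt [set: G] D d))%R.
Proof.
rewrite /x_part /lambda (perm_big _ (permEl (perm_sort _ _))) /= big_map big_enum /=.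
rewrite componentsE big_imset /=.
  apply: eq_bigr => d _; congr x_; apply: eq_card => u; rewrite !inE.
  by [].
move=> d d' dD dD' /setP/(_ d); rewrite !inE (top_in rt dD) eqxx => /esym/eqP.
by [].
Qed.

End Cut.

(** Edge sets [A] correspond to sets [D] containing the apex: the edges in [A]
are those from the elements of [D], except for the apex, to their parents. *)
Lemma Upoly_cuts k : Upoly k G =
  (\sum_(D : {set G} | (r \in D) && (#|D| <= k.+1)%N)
     \prod_(d in D) x_ (block rt [set: G] D d))%R.
Proof.
rewrite /Upoly (reindex_onto (fun D : {set G} => edge @: (D :\ r))
   (fun A => r |: [set u | (u != r) && (edge u \in A)])) /=; last first.
  move=> A /andP[]; rewrite edgesE => /subsetP AE _; apply/setP => e.
  apply/imsetP/idP => [[u]|eA].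
    by rewrite !inE => /andP[ur /orP[/eqP ur'|/andP[_ uA]]] ->; rewrite ?ur' ?eqxx in ur *.
  have /imsetP[u] := AE e eA; rewrite !inE => ur eu; exists u => //.
  by rewrite !inE ur -eu eA orbT.
rewrite (eq_bigl (fun D : {set G} => (r \in D) && (#|D| <= k.+1))); last first.
  move=> D /=.
  have cardE : r \in D -> #|edge @: (D :\ r)| = #|D|.-1.
    move=> rD; rewrite card_in_imset ?(cardsD1 r D) ?rD // => u w.
    by rewrite !inE => /andP[ur _] /andP[wr _]; apply: edge_inj; rewrite !inE.
  apply/idP/idP => [/andP[/andP[_ Dk] /eqP DE]|/andP[rD Dk]].
    have rD : r \in D by rewrite -DE setU11.
    by rewrite rD; move: Dk; rewrite cardE //; lia.
  rewrite cardE //; apply/andP; split; last first.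
    apply/eqP/setP => u; rewrite !inE; have [->|ur] := eqVneq u r; first by rewrite rD.
    apply/imsetP/idP => [[w]|uD]; last by exists u; rewrite ?inE ?ur.
    by rewrite !inE => /andP[wr wD] /edge_inj ->; rewrite ?inE.
  rewrite edgesE imsetS; first by lia.
  by apply/subsetP => u; rewrite !inE => /andP[].
by apply: eq_bigr => D /andP[rD _]; apply: x_part_lambda.
Qed.

End RootedGraph.

(** * Specializing the indeterminates *)

Section Evaluation.
Variables (S : comNzRingType) (w : nat -> S).
Local Open Scope ring_scope.

Definition cmonom_eval (m : {cmonom nat}) : S :=
  \prod_(i <- finsupp m) w i ^+ m i.

Lemma cmonom_evalE (d : {fset nat}) (m : {cmonom nat}) :
  (finsupp m `<=` d)%fset -> cmonom_eval m = \prod_(i <- d) w i ^+ m i.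
Proof.
move=> md; rewrite /cmonom_eval (big_fset_incl _ md) // => i _.
by rewrite -cmE_eq0 => /eqP ->.
Qed.

Lemma cmonom_eval_mmorphism : mmorphism cmonom_eval.
Proof.
split=> [m m' /=|]; last by rewrite /cmonom_eval mdom1 big_seq_fset0.
rewrite {1}/cmonom_eval mdomD (cmonom_evalE (fsubsetUl _ (finsupp m'))).
rewrite (cmonom_evalE (fsubsetUr (finsupp m) _)) -big_split /=.
by apply: eq_bigr => i _; rewrite cmM exprD.
Qed.

HB.instance Definition _ :=
  isMultiplicative.Build {cmonom nat} S cmonom_eval cmonom_eval_mmorphism.

Definition xeval : {rmorphism xpoly -> S} :=
  GRing.RMorphism.clone _ _ (mmap (intr : int -> S) cmonom_eval) _.

Lemma xeval_x i : xeval (x_ i) = w i.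
Proof.
rewrite /= mmapU /cmonom_eval mdomU big_seq_fset1 cmUU.
exact: mul1r.
Qed.

End Evaluation.

Lemma torsion_free_int : torsion_free int.
Proof.
move=> m v m0 /eqP; rewrite Num.Theory.mulrn_eq0 => /orP[/eqP m00|/eqP //].
by rewrite m00 in m0.
Qed.

Lemma torsion_free_xpoly : torsion_free xpoly.
Proof.
move=> m v m0 vm; apply/malgP => k; rewrite mcoeff0.
by apply: (torsion_free_int m0); rewrite -mcoeffMn vm mcoeff0.
Qed.

Section CutCount.
Variables (G : sgraph) (rt : rooting G).
Hypothesis adjE : @adj G =2 tree_adj rt.
Local Open Scope ring_scope.

Definition cut_count (R : comNzRingType) (z : nat -> R) m : R :=
  \sum_(D : {set G} | (apex rt \in D) && (#|D| == m.+1))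
     \prod_(d in D) z (block rt [set: G] D d).

Lemma zlin_desc_sum (R : comNzRingType) (z : nat -> R) m :
  zlin z (desc_sum rt z (apex rt))`_m = cut_count z m.
Proof.
apply: polyC_inj; rewrite -coef_close_root /desc_sum desc_apex close_cut_sum.
rewrite coef_sum /cut_count rmorph_sum /= [RHS]big_mkcondr.
apply: eq_big => [D|D /andP[_ rD]]; first by rewrite subsetT.
have D0 : (0 < #|D|)%N by apply/card_gt0P; exists (apex rt).
rewrite /closed_term; set c := \prod_(d in D) z _.
have -> : \prod_(d in D) zconst z (block rt setT D d) = c%:P%:P by rewrite /c !rmorph_prod.
move: c => c; rewrite -[in RHS](prednK D0) eqSS coefXnM coefC.
have [mD|mD] := ltnP m #|D|.-1; first by rewrite gtn_eqF.
by rewrite subn_eq0 eqn_leq mD.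
Qed.

Lemma Upoly_cut_count k : Upoly k G = \sum_(m < k.+1) cut_count x_ m.
Proof.
rewrite (Upoly_cuts adjE).
rewrite (partition_big (fun D : {set G} => inord #|D|.-1 : 'I_k.+1) xpredT) //=.
apply: eq_bigr => m _; apply: eq_bigl => D; rewrite -andbA.
case: (boolP (_ \in D)) => //= rD.
have D0 : (0 < #|D|)%N by apply/card_gt0P; exists (apex rt).
rewrite -val_eqE /=; apply/andP/eqP => [[Dk]|Dm].
  by rewrite inordK; [move=> /eqP; lia | lia].
by have := ltn_ord m; rewrite Dm => mk; rewrite inordK.
Qed.

(** The number of components is one more than the number of cuts. Multiplying
every indeterminate by ['X] therefore separates the numbers of cuts that are
added up in [Upoly]. *)
Lemma xeval_Upoly (z : nat -> int) k m : (m <= k)%N ->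
  (xeval (fun i => z i *: 'X) (Upoly k G))`_m.+1 = cut_count z m.
Proof.
move=> mk; rewrite (Upoly_cuts adjE) rmorph_sum coef_sum /cut_count.
rewrite [LHS]big_mkcondr [RHS]big_mkcondr; apply: eq_bigr => D rD.
rewrite rmorph_prod; under eq_bigr => d _ do rewrite xeval_x.
rewrite scaler_prod prodr_const coefZ coefXn [m.+1 == _]eq_sym.
by case: eqP => [->|_]; rewrite ?mulr0 ?mulr1 ?ltnS ?mk //; case: ifP.
Qed.

End CutCount.

(** * The rooting of a PTE-tree *)

Section BunchRooting.
Variables a b : nat.
Implicit Types (i : copy a b) (x y : Bvertex a b).

(** The vertices of a copy other than the root: [w0] is the neighbour of the
root, followed by [w1] and [w2] along the path, or adjacent to the leaves [w1]
and [w2] in the star. *)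
Definition w0 : 'I_3 := Ordinal (isT : 0 < 3).
Definition w1 : 'I_3 := Ordinal (isT : 1 < 3).
Definition w2 : 'I_3 := Ordinal (isT : 2 < 3).

Lemma ord3P (P : 'I_3 -> Prop) : P w0 -> P w1 -> P w2 -> forall w, P w.
Proof.
move=> P0 P1 P2 [[|[|[|//]]] lt3].
- by rewrite (_ : Ordinal lt3 = w0) //; apply: val_inj.
- by rewrite (_ : Ordinal lt3 = w1) //; apply: val_inj.
- by rewrite (_ : Ordinal lt3 = w2) //; apply: val_inj.
Qed.

Definition copy_parent i (w : 'I_3) : option 'I_3 :=
  match val w, i with
  | 0, _ => None
  | 1, _ => Some w0
  | _, inl _ => Some w1
  | _, inr _ => Some w0
  end.

Definition Bparent x : Bvertex a b :=
  if x is Some (i, w) then omap (pair i) (copy_parent i w) else None.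

Definition Bdepth x : nat :=
  match x with
  | None => 0
  | Some (inr _, w) => minn w.+1 2
  | Some (inl _, w) => w.+1
  end.

Lemma Bdepth_parent x : x != None -> Bdepth x = (Bdepth (Bparent x)).+1.
Proof. by case: x => // -[[j|j]]; elim/ord3P. Qed.

(** The vertices of a copy are written as [option 'I_3], the root being
[None]. *)
Lemma copy_adj_parent i (u v : option 'I_3) :
  copy_adj i (oapp (lift ord0) ord0 u) (oapp (lift ord0) ord0 v)
    = (u != None) && (obind (copy_parent i) u == v)
      || (v != None) && (obind (copy_parent i) v == u).
Proof.
by case: i => j; case: u => [|]; case: v => [|] //;
   repeat (elim/ord3P || move=> ?).
Qed.

Lemma BadjE x y :
  Badj x y = (x != None) && (Bparent x == y) || (y != None) && (Bparent y == x).
Proof.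
have glueE i u : glue i (oapp (lift ord0) ord0 u) = omap (pair i) u.
  by case: u => [u|]; rewrite /glue /= ?liftK ?unlift_none.
have unglue (u : 'I_4) : exists v, u = oapp (lift ord0) ord0 v.
  by case: (unliftP ord0 u) => [v ->|->]; [exists (Some v) | exists None].
apply/existsP/idP => [[i /existsP[u0 /existsP[v0 /and3P[]]]]|].
  have [[u ->] [v ->]] := (unglue u0, unglue v0).
  rewrite copy_adj_parent !glueE => uv /eqP<- /eqP<-.
  case: u v uv => [u|] [v|] //=; rewrite ?andbF ?orbF //=.
  - by case/orP=> /eqP ->; rewrite ?eqxx ?orbT.
  - by move=> /eqP ->.
  - by move=> /eqP ->.
have adj_parent i w : [exists u, exists v,
    [&& copy_adj i u v, glue i u == Some (i, w) & glue i v == Bparent (Some (i, w))]].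
  apply/existsP; exists (oapp (lift ord0) ord0 (Some w)).
  apply/existsP; exists (oapp (lift ord0) ord0 (copy_parent i w)).
  by rewrite copy_adj_parent !glueE !eqxx.
case/orP=> /andP[].
  by case: x => // -[i w] _ /eqP <-; exists i; apply: adj_parent.
case: y => // -[i w] _ /eqP <-; exists i.
have /existsP[u /existsP[v /and3P[uv uE vE]]] := adj_parent i w.
apply/existsP; exists v; apply/existsP; exists u.
by rewrite copy_adj_sym uv uE vE.
Qed.

End BunchRooting.

Section PTERooting.
Variables (n : nat) (p s : n.-tuple nat).
Local Notation V := (PTEvertex p s).

Definition in_bunch (i : 'I_n) (x : Bvertex (tnth p i) (tnth s i)) : V :=
  Some (Tagged (fun i => Bgraph (tnth p i) (tnth s i)) x).

Definition PTEparent (x : V) : V :=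
  if x is Some t then
    if tagged t is Some _ then in_bunch (Bparent (tagged t)) else None
  else None.

Definition PTEdepth (x : V) : nat :=
  if x is Some t then (Bdepth (tagged t)).+1 else 0.

Lemma PTEdepth_parent (x : V) : x != None -> PTEdepth x = (PTEdepth (PTEparent x)).+1.
Proof. by case: x => // -[i [[c w]|]] // _; congr _.+1; apply: Bdepth_parent. Qed.

Definition PTErooting : rooting (PTEgraph p s) :=
  @Rooting (PTEgraph p s) None PTEparent PTEdepth erefl PTEdepth_parent.

Lemma in_bunch_inj i : injective (@in_bunch i).
Proof. by move=> x y /Some_inj/eqP; rewrite eq_Tagged => /eqP. Qed.

Lemma PTEadjE : @adj (PTEgraph p s) =2 tree_adj PTErooting.
Proof.
move=> [[i x]|] [[j y]|] //; rewrite /tree_adj /= ?andbF ?orbF //.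
- have [ij|ij] := eqVneq i j; last first.
    apply/esym/norP; split; [case: x => [?|]|case: y => [?|]]; rewrite //=;
      by apply: contra ij => /eqP/Some_inj/(congr1 tag) /= ->.
  case: _ / ij y => y; rewrite tagged_asE BadjE /=.
  congr (_ || _); [case: x => [x|] //=|case: y => [y|] //=].
    by rewrite -(inj_eq (@in_bunch_inj i)).
  by rewrite -(inj_eq (@in_bunch_inj i)).
- by case: x.
- by case: y.
Qed.

Section BranchSums.
Variables (R : comNzRingType) (z : nat -> R).
Local Open Scope ring_scope.
Local Notation bs := (desc_sum PTErooting z).
Local Notation close g := (g + 'X * close_root z g).

Lemma prod_children i (x : Bvertex (tnth p i) (tnth s i))
    (f : V -> {poly {poly R}}) :
  \prod_(c | child PTErooting (in_bunch x) c) f c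
    = \prod_(y : Bvertex (tnth p i) (tnth s i) | (y != None) && (Bparent y == x))
        f (in_bunch y).
Proof.
rewrite -(big_imset f (h := @in_bunch i)) /=; last by move=> ? ? _ _; apply: in_bunch_inj.
apply: eq_bigl => c; apply/idP/imsetP => [|[y]].
  case: c => [[j [y|]]|] // /andP[_ /= /eqP E].
  have ij : j = i by move/Some_inj/(congr1 tag): E.
  case: _ / ij x E => x /in_bunch_inj E; exists (Some y) => //.
  by rewrite -topredE /= E eqxx.
rewrite -topredE /= => /andP[y0 /eqP yx] ->.
by case: y y0 yx => // y _ yx; apply/andP; split=> //; apply/eqP/(congr1 (@in_bunch i) yx).
Qed.

Let bs_children v := desc_sum_children PTErooting z v.

(** The recursion [desc_sum_children] along the three vertices of a copy. *)
Lemma desc_sum_copy i (c : copy (tnth p i) (tnth s i)) :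
  close (bs (in_bunch (Some (c, w0)))) = if c is inl _ then path_copy z else star_copy z.
Proof.
have leaf w : (forall w', copy_parent c w' != Some w) ->
    bs (in_bunch (Some (c, w))) = yvar R.
  move=> noparent; rewrite bs_children prod_children big_pred0 ?mulr1 // => -[[d w']|] //=.
  case E : (copy_parent d w') => [w''|] //=; apply/eqP => -[dc w'w].
  by have := noparent w'; rewrite -dc E w'w eqxx.
have close_mono j m e :
  close_root z ('X^j * (m%:P%:P * yvar R ^+ e)) = 'X^j * (m%:P%:P * zconst z e).
  by rewrite close_rootXn close_rootC -polyC_exp close_root_polyC zlinXn.
have closey : close (yvar R) = yvar R + 'X * zconst z 1.
  by have := close_mono 0 1 1; rewrite expr0 expr1 !mul1r => ->.
have eqSome (d d' : copy (tnth p i) (tnth s i)) (w w' : 'I_3) :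
  (Some (d, w) == Some (d', w')) = (d == d') && (w == w') by [].
case: c => j in leaf *.
  have bs2 : bs (in_bunch (Some (inl j, w2))) = yvar R by apply: leaf; elim/ord3P.
  have bs1 : bs (in_bunch (Some (inl j, w1))) = yvar R * (yvar R + 'X * zconst z 1).
    rewrite bs_children prod_children (big_pred1 (Some (inl j, w2))) ?bs2 ?closey //.
    by case=> [[[d|d] w]|] //; elim/ord3P: w; rewrite //= !eqSome ?andbF ?andbT.
  have bs0 : bs (in_bunch (Some (inl j, w0)))
      = yvar R * close (bs (in_bunch (Some (inl j, w1)))).
    rewrite bs_children prod_children (big_pred1 (Some (inl j, w1))) //.
    by case=> [[[d|d] w]|] //; elim/ord3P: w; rewrite //= !eqSome ?andbF ?andbT.
  have closed1 : close_root z (bs (in_bunch (Some (inl j, w1))))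
      = zconst z 2 + 'X * zconst z 1 ^+ 2.
    rewrite bs1 (_ : _ * _ = 'X^0 * (1%:P%:P * yvar R ^+ 2)
      + 'X^1 * ((z 1)%:P%:P * yvar R ^+ 1)); last by rewrite /zconst !polyC1; ring.
    by rewrite raddfD /= !close_mono !polyC1; ring.
  have closed0 : close_root z (bs (in_bunch (Some (inl j, w0))))
      = zconst z 3 + 'X * (zconst z 1 * zconst z 2 *+ 2) + 'X^2 * zconst z 1 ^+ 3.
    rewrite bs0 closed1 bs1 (_ : _ * _ = 'X^0 * (1%:P%:P * yvar R ^+ 3)
      + 'X^1 * ((z 1)%:P%:P * yvar R ^+ 2) + 'X^1 * ((z 2)%:P%:P * yvar R ^+ 1)
      + 'X^2 * ((z 1 ^+ 2)%:P%:P * yvar R ^+ 1)).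
      by rewrite !raddfD /= !close_mono !polyC1 !polyC_exp -/(zconst z 1) -/(zconst z 2); ring.
    by rewrite !polyC1 !polyC_exp -/(zconst z 1) -/(zconst z 2); ring.
  by rewrite closed0 bs0 closed1 bs1 /path_copy /star_copy /copy_diff; ring.
have bsw w : w != w0 -> bs (in_bunch (Some (inr j, w))) = yvar R.
  by elim/ord3P: w => // _; apply: leaf; elim/ord3P.
have bs0 : bs (in_bunch (Some (inr j, w0))) = yvar R * (yvar R + 'X * zconst z 1) ^+ 2.
  rewrite bs_children prod_children (bigD1 (Some (inr j, w1))) /=; last by rewrite eqxx.
  rewrite (big_pred1 (Some (inr j, w2))); first by rewrite !bsw // closey expr2.
  by case=> [[[d|d] w]|] //; elim/ord3P: w; rewrite //= !eqSome ?andbF ?andbT //; case: eqP.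
have closed0 : close_root z (bs (in_bunch (Some (inr j, w0))))
    = zconst z 3 + 'X * (zconst z 1 * zconst z 2 *+ 2) + 'X^2 * zconst z 1 ^+ 3.
  rewrite bs0 (_ : _ * _ = 'X^0 * (1%:P%:P * yvar R ^+ 3)
    + ('X^1 * ((z 1)%:P%:P * yvar R ^+ 2) + 'X^1 * ((z 1)%:P%:P * yvar R ^+ 2))
    + 'X^2 * ((z 1 ^+ 2)%:P%:P * yvar R ^+ 1)).
    by rewrite !raddfD /= !close_mono !polyC1 !polyC_exp -/(zconst z 1); ring.
  by rewrite !polyC1 !polyC_exp -/(zconst z 1); ring.
by rewrite closed0 bs0 /star_copy; ring.
Qed.

Lemma prod_root_children (f : V -> {poly {poly R}}) :
  \prod_(c | child PTErooting None c) f c = \prod_(i < n) f (@in_bunch i None).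
Proof.
rewrite -(big_imset f (h := fun i => @in_bunch i None)) /=.
  apply: eq_bigl => c; apply/idP/imsetP => [|[i _ ->] //].
  by case: c => [[j [y|]]|] //= _; exists j.
by move=> i j _ _ /Some_inj/(congr1 tag).
Qed.

Lemma desc_sum_bunch i :
  bs (@in_bunch i None) = yvar R * path_copy z ^+ tnth p i * star_copy z ^+ tnth s i.
Proof.
rewrite bs_children prod_children -mulrA; congr (_ * _).
pose f (x : Bvertex (tnth p i) (tnth s i)) := close (bs (in_bunch x)).
rewrite (eq_bigl [in [set Some (c, w0) | c : copy (tnth p i) (tnth s i)]]); last first.
  move=> x; apply/idP/imsetP => [|[c _ ->] //].
  by case: x => [[[d|d] w]|] //; elim/ord3P: w => // _; eexists.
rewrite big_imset /=; last by move=> c d _ _ [].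
under eq_bigr => c _ do rewrite desc_sum_copy.
by rewrite big_sumType /= !prodr_const !card_ord.
Qed.

Lemma desc_sum_PTE :
  bs None = yvar R * \prod_(i < n)
    close (yvar R * path_copy z ^+ tnth p i * star_copy z ^+ tnth s i).
Proof.
rewrite bs_children prod_root_children; congr (_ * _).
by apply: eq_bigr => i _; rewrite desc_sum_bunch.
Qed.

End BranchSums.

End PTERooting.

Lemma desc_sum_T (R : comNzRingType) (z : nat -> R) alpha p :
  desc_sum (PTErooting (in_tuple p) [tuple of [seq alpha - a | a <- in_tuple p]]) z None
    = PTE_cut_poly z alpha p.
Proof.
rewrite desc_sum_PTE /PTE_cut_poly big_tnth; congr (_ * _)%R.
by apply: eq_bigr => i _; rewrite tnth_map.
Qed.

(** * Transport along isomorphisms *)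

Section Transport.
Variables (V W : finType) (f : W -> V) (g : V -> W).
Hypotheses (fK : cancel f g) (gK : cancel g f).
Variable rt : rooting V.

Lemma transport_depth_parent (u : W) : u != g (apex rt) ->
  depth rt (f u) = (depth rt (f (g (parent rt (f u))))).+1.
Proof. by move=> ur; rewrite gK; apply: depth_parent; rewrite (can2_eq fK gK). Qed.

Definition transport_rooting : rooting W :=
  @Rooting W (g (apex rt)) (fun u => g (parent rt (f u))) (fun u => depth rt (f u))
    (etrans (congr1 (depth rt) (gK _)) (depth_apex rt)) transport_depth_parent.

(** By induction from the leaves: the depth of a child exceeds that of its
parent and is bounded. *)
Lemma desc_sum_transport (R : comNzRingType) (z : nat -> R) v :
  desc_sum transport_rooting z (g v) = desc_sum rt z v.
Proof.
pose M := \max_(u : V) depth rt u; have [m] := ubnP (M - depth rt v).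
elim: m v => // m IH v vm; rewrite !desc_sum_children; congr (_ * _)%R.
rewrite (reindex g) /=; last by exists f => ? _.
apply: eq_big => c; first by rewrite /child /= gK !(inj_eq (can_inj gK)).
rewrite /child /= gK !(inj_eq (can_inj gK)) => vc; rewrite IH //.
have := depth_child (vc : child rt v c).
have : depth rt c <= M by apply: leq_bigmax.
by move: vm; lia.
Qed.

End Transport.

Section Isomorphism.
Variables (G H : sgraph) (f : G -> H).
Hypotheses (f_bij : bijective f) (f_adj : forall x y, adj (f x) (f y) = adj x y).
Variable rt : rooting H.
Hypothesis adjE : @adj H =2 tree_adj rt.

Lemma transport_adj : exists rtG : rooting G, @adj G =2 tree_adj rtG /\
  forall (R : comNzRingType) (z : nat -> R),
    desc_sum rtG z (apex rtG) = desc_sum rt z (apex rt).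
Proof.
have [g fK gK] := f_bij; exists (transport_rooting fK gK rt); split; last first.
  by move=> R z; apply: desc_sum_transport.
move=> x y; rewrite -f_adj adjE /tree_adj /=.
by rewrite !(can2_eq gK fK) !(can2_eq fK gK) // ![g _ == _]eq_sym.
Qed.

End Isomorphism.

(** * Sequences and trees up to order *)

(** Power sums determine the sum over the entries of any polynomial of degree at
most [alpha], and the polynomial that vanishes on [0, ..., alpha] except at [v]
counts the entries equal to [v]. *)
Lemma psum_perm_eq alpha p p' :
  all (leq^~ alpha) p -> all (leq^~ alpha) p' ->
  (forall l, l <= alpha -> psum l p = psum l p') -> perm_eq p p'.
Proof.
move=> pal pal' pp'; apply/allP => v vpp'; apply/eqP.
have vale : v <= alpha.
  by move: vpp'; rewrite mem_cat => /orP[/(allP pal)|/(allP pal')].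
pose s := rem v (iota 0 alpha.+1).
pose f : {poly int} := (\prod_(u <- s) ('X - (Posz u)%:P))%R.
have vs : v \in iota 0 alpha.+1 by rewrite mem_iota.
have sf : size f = alpha.+1 by rewrite size_prod_XsubC size_rem // size_iota.
have fE a : (f.[Posz a] = \prod_(u <- s) (Posz a - Posz u))%R.
  by rewrite horner_prod; apply: eq_bigr => u _; rewrite !hornerE.
have mem_s u : (u \in s) = (u != v) && (u <= alpha).
  by rewrite mem_rem_uniq ?iota_uniq // inE mem_iota.
have f0 a : a <= alpha -> a != v -> (f.[Posz a] = 0)%R.
  move=> aal av; rewrite fE; apply/eqP; rewrite prodf_seq_eq0; apply/hasP; exists a.
    by rewrite mem_s av.
  by rewrite /= subrr.
have fv : (f.[Posz v] != 0)%R.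
  rewrite fE prodf_seq_neq0; apply/allP => u; rewrite mem_s => /andP[uv _].
  by rewrite subr_eq0 eqz_nat eq_sym.
have sum_f q : all (leq^~ alpha) q ->
    (\sum_(a <- q) f.[Posz a] = f.[Posz v] *+ count_mem v q)%R.
  elim: q => [|a q IH] /=; first by rewrite big_nil.
  case/andP=> aal /IH; rewrite big_cons => ->; case: eqVneq => [->|av].
    by rewrite mulrS.
  by rewrite f0 // add0r.
have sum_psum q : (\sum_(a <- q) f.[Posz a] = \sum_(i < size f) f`_i * (psum i q)%:R)%R.
  under eq_bigr => a _ do rewrite horner_coef.
  rewrite exchange_big; apply: eq_bigr => i _ /=; rewrite /psum natr_sum mulr_sumr.
  by apply: eq_bigr => a _; rewrite natrX natz.
have : (f.[Posz v] *+ count_mem v p = f.[Posz v] *+ count_mem v p')%R.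
  rewrite -!sum_f // !sum_psum; apply: eq_bigr => i _; rewrite pp' //.
  by rewrite -ltnS -sf.
rewrite -[LHS]mulr_natr -[RHS]mulr_natr => /(mulfI fv).
by rewrite !natz => -[].
Qed.

Lemma isomorphic_trans G H K : isomorphic G H -> isomorphic H K -> isomorphic G K.
Proof.
move=> [f [f_bij f_adj]] [g [g_bij g_adj]]; exists (g \o f).
by split=> [|x y]; [apply: bij_comp | rewrite /= g_adj f_adj].
Qed.

Lemma isomorphic_sym G H : isomorphic G H -> isomorphic H G.
Proof.
move=> [f [[g fK gK] f_adj]]; exists g; split; first by exists f.
by move=> x y; rewrite -f_adj !gK.
Qed.

Section Relabel.
Variables a b a' b' : nat.
Hypotheses (eqa : a = a') (eqb : b = b').

(** Bunches are indexed by the numbers of their copies; equal numbers give the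
same bunch only up to this cast. *)
Definition Bcast (x : Bvertex a b) : Bvertex a' b' :=
  ecast c (Bvertex c b') eqa (ecast d (Bvertex a d) eqb x).

Lemma Bcast_inj : injective Bcast.
Proof. by rewrite /Bcast; case: _ / eqa; case: _ / eqb. Qed.

Lemma Bcast_root : Bcast None = None.
Proof. by rewrite /Bcast; case: _ / eqa; case: _ / eqb. Qed.

Lemma Bcast_adj x y : Badj (Bcast x) (Bcast y) = Badj x y.
Proof. by rewrite /Bcast; move: x y; case: _ / eqa; case: _ / eqb. Qed.

End Relabel.

Section PTEmap.
Variables (n m : nat) (p s : n.-tuple nat) (p' s' : m.-tuple nat).
Variable sigma : 'I_n -> 'I_m.
Hypothesis sigma_inj : injective sigma.
Hypothesis pE : forall i, tnth p i = tnth p' (sigma i).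
Hypothesis sE : forall i, tnth s i = tnth s' (sigma i).

Definition PTEmap (x : PTEgraph p s) : PTEgraph p' s' :=
  if x is Some t then in_bunch (Bcast (pE (tag t)) (sE (tag t)) (tagged t)) else None.

Lemma PTEmap_inj : injective PTEmap.
Proof.
move=> [[i x]|] [[j y]|] //= E.
have ij : i = j by apply: sigma_inj; move/Some_inj/(congr1 tag): E.
by case: _ / ij y E => y /in_bunch_inj/Bcast_inj ->.
Qed.

Lemma PTEmap_adj x y : adj (PTEmap x) (PTEmap y) = adj x y.
Proof.
have root_eq i (u : Bvertex (tnth p i) (tnth s i)) :
  (Bcast (pE i) (sE i) u == None) = (u == None).
  by rewrite -(inj_eq (@Bcast_inj _ _ _ _ (pE i) (sE i))) Bcast_root.
case: x y => [[i x]|] [[j y]|] //=; rewrite ?root_eq //.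
rewrite (inj_eq sigma_inj); have [ij|//] := eqVneq i j.
by case: _ / ij y => y; rewrite !tagged_asE Bcast_adj.
Qed.

End PTEmap.

Lemma perm_eq_index (p p' : seq nat) : perm_eq p p' ->
  exists sigma : 'I_(size p) -> 'I_(size p'),
    injective sigma /\ forall i : 'I_(size p), nth 0 p i = nth 0 p' (sigma i).
Proof.
move=> pp'; have [Is IsP pE] := perm_iotaP 0 pp'.
have sizeIs : size Is = size p by rewrite pE size_map.
have lt_Is (i : 'I_(size p)) : nth 0 Is i < size p'.
  have : nth 0 Is i \in Is by rewrite mem_nth ?sizeIs.
  by rewrite (perm_mem IsP) mem_iota.
exists (fun i => Ordinal (lt_Is i)); split=> [i j /(congr1 val)/= /eqP|i].
  rewrite nth_uniq ?sizeIs // ?(perm_uniq IsP) ?iota_uniq //.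
  by move=> /eqP; apply: val_inj.
by rewrite {1}pE (nth_map 0) ?sizeIs.
Qed.

(** A permutation of the entries permutes the bunches. This gives injective
morphisms in both directions, so each of them is bijective by counting. *)
Lemma perm_eq_isomorphic alpha p p' :
  perm_eq p p' -> isomorphic (T_ alpha p) (T_ alpha p').
Proof.
have inj q q' : perm_eq q q' ->
    exists f : T_ alpha q -> T_ alpha q',
      injective f /\ forall x y, adj (f x) (f y) = adj x y.
  move=> /perm_eq_index[sigma [sigma_inj qE]].
  have pE i : tnth (in_tuple q) i = tnth (in_tuple q') (sigma i).
    by rewrite !(tnth_nth 0) /= qE.
  have sE i : tnth [tuple of [seq alpha - a | a <- in_tuple q]] i
    = tnth [tuple of [seq alpha - a | a <- in_tuple q']] (sigma i).
    by rewrite !tnth_map pE.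
  exists (PTEmap pE sE); split; first exact: PTEmap_inj.
  exact: PTEmap_adj.
move=> pp'; have [f [f_inj f_adj]] := inj _ _ pp'.
have [g [g_inj _]] : exists g : T_ alpha p' -> T_ alpha p,
    injective g /\ forall x y, adj (g x) (g y) = adj x y.
  by apply: inj; rewrite perm_sym.
by exists f; split=> //; apply: inj_card_bij f_inj (leq_card g g_inj).
Qed.

(** * From power sums to the polynomial and back *)

Lemma compatible_all alpha p : compatible alpha p -> all (leq^~ alpha) p.
Proof. by case=> _ _ /bigmax_leqP_seq ap; apply/allP => a /ap; apply. Qed.

Lemma PTE_rooting alpha p G : PTE_tree alpha p G ->
  exists rt : rooting G, @adj G =2 tree_adj rt /\
    forall (R : comNzRingType) (z : nat -> R),
      desc_sum rt z (apex rt) = PTE_cut_poly z alpha p.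
Proof.
case=> _ _ [f [f_bij f_adj]].
have [rt [adjE bsE]] := transport_adj f_bij f_adj (@PTEadjE _ _ _).
by exists rt; split=> // R z; rewrite bsE desc_sum_T.
Qed.

Lemma Upoly_PTE alpha p G k : PTE_tree alpha p G ->
  Upoly k G = (\sum_(m < k.+1) zlin x_ (PTE_cut_poly x_ alpha p)`_m)%R.
Proof.
case/PTE_rooting=> rt [adjE bsE]; rewrite (Upoly_cut_count adjE).
by apply: eq_bigr => m _; rewrite -zlin_desc_sum bsE.
Qed.

Lemma Upoly_eq_PTE alpha p G alpha' p' G' k :
  PTE_tree alpha p G -> PTE_tree alpha' p' G' -> Upoly k G = Upoly k G' ->
  forall (z : nat -> int) m, m <= k ->
    zlin z (PTE_cut_poly z alpha p)`_m%R = zlin z (PTE_cut_poly z alpha' p')`_m%R.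
Proof.
move=> /PTE_rooting[rt [adjE bsE]] /PTE_rooting[rt' [adjE' bsE']] UU' z m mk.
rewrite -bsE -bsE' !zlin_desc_sum -(xeval_Upoly adjE z mk) UU'.
exact: xeval_Upoly.
Qed.

Lemma psum_Upoly alpha p p' G G' k :
  PTE_tree alpha p G -> PTE_tree alpha p' G' -> 0 < k ->
  (forall l, l <= k -> psum l p = psum l p') ->
  Upoly k.+1 G = Upoly k.+1 G'.
Proof.
move=> PT PT' k0 pp'; rewrite (Upoly_PTE _ PT) (Upoly_PTE _ PT').
have [[_ /compatible_all pal _] [_ /compatible_all pal' _]] := (PT, PT').
apply: eq_bigr => m _; congr (zlin x_ _); rewrite /PTE_cut_poly !coefCM; congr (_ * _)%R.
apply: (@eqm_prod_branch _ x_ torsion_free_xpoly alpha k.+1) => //.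
- by rewrite -!psum0 pp'.
- exact: pp'.
Qed.

(** The next results only use that the sums over all sets of at most [k + 1]
cuts agree, for all integral values of the indeterminates. Let [N] be the number
of vertices of the trees. *)

Section Invariants.
Variables (k alpha alpha' : nat) (p p' : seq nat).
Hypotheses (k0 : 0 < k) (cp : compatible alpha p) (cp' : compatible alpha' p').
Hypothesis eq_cuts : forall (z : nat -> int) m, m <= k.+1 ->
  zlin z (PTE_cut_poly z alpha p)`_m%R = zlin z (PTE_cut_poly z alpha' p')`_m%R.

Let pal := compatible_all cp.
Let pal' := compatible_all cp'.
Let p2 : 1 < size p. Proof. by case: cp. Qed.
Let p2' : 1 < size p'. Proof. by case: cp'. Qed.
Let al0 : 0 < alpha. Proof. by case: cp. Qed.
Let al0' : 0 < alpha'. Proof. by case: cp'. Qed.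

Let N := (3 * alpha + 1) * size p + 1.

(** No cut at all: there is one component, of size [N]. *)
Lemma order_invariant : N = (3 * alpha' + 1) * size p' + 1.
Proof.
have := eq_cuts (fun i => (i == N)%:R)%R (leq0n k.+1).
by rewrite !zlin_PTE_cut_poly0 // eqxx; case: eqP => // ->.
Qed.

Lemma size_bound a (q : seq nat) : 0 < a -> 1 < size q ->
  6 * a + 3 <= (3 * a + 1) * size q + 1.
Proof.
move=> a0 q2; have : (3 * a + 1) * 2 <= (3 * a + 1) * size q.
  by rewrite leq_mul2l q2 orbT.
by lia.
Qed.

Let N_bound : 6 * alpha + 3 <= N. Proof. exact: size_bound. Qed.
Let N_bound' : 6 * alpha' + 3 <= N.
Proof. by rewrite order_invariant; apply: size_bound. Qed.

Let eq_cuts1 (z : nat -> int) : (z 1 = 0)%R ->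
  ((z 3 * z (N - 3)%N *+ (size p * alpha) + z 2 * z (N - 2)%N *+ psum 1 p
      + z (3 * alpha + 1)%N * z (N - (3 * alpha + 1))%N *+ size p)
  = (z 3 * z (N - 3)%N *+ (size p' * alpha') + z 2 * z (N - 2)%N *+ psum 1 p'
      + z (3 * alpha' + 1)%N * z (N - (3 * alpha' + 1))%N *+ size p'))%R.
Proof.
move=> z1; have := eq_cuts z (ltn0Sn k); rewrite !zlin_PTE_cut_poly1 //.
by rewrite -order_invariant.
Qed.

(** Cuts into [3] and [N - 3] vertices correspond to the copies. Together with
their number, [N] determines the number of bunches. *)
Lemma sizes_invariant : size p = size p' /\ alpha = alpha'.
Proof.
pose z (i : nat) : int := Posz ((i == 3) || (i == N - 3)).
have z0 i : i != 3 -> i != N - 3 -> z i = 0%R by rewrite /z => /negbTE-> /negbTE->.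
have : size p * alpha = size p' * alpha'.
  have := @eq_cuts1 z; rewrite (z0 1) ?(z0 2) ?(z0 (3 * _ + 1)); try lia.
  rewrite !mul0r !mul0rn !addr0 {1 3}/z eqxx mul1r /z eqxx orbT => /(_ erefl).
  by rewrite !natz => -[].
move=> E; have pp' : size p = size p'.
  by have := order_invariant; rewrite /N; move: E; nia.
split=> //; apply/eqP; move/eqP: E; rewrite pp' eqn_pmul2l //; exact: ltnW p2'.
Qed.

(** Cuts into [2] and [N - 2] vertices correspond to the path copies. *)
Lemma psum1_invariant : psum 1 p = psum 1 p'.
Proof.
pose z (i : nat) : int := Posz ((i == 2) || (i == N - 2)).
have z0 i : i != 2 -> i != N - 2 -> z i = 0%R by rewrite /z => /negbTE-> /negbTE->.
have := @eq_cuts1 z; rewrite (z0 1) ?(z0 3) ?(z0 (3 * _ + 1)); try lia.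
rewrite !mul0r !mul0rn !addr0 !add0r {1 3}/z eqxx mul1r /z eqxx orbT => /(_ erefl).
by rewrite !natz => -[].
Qed.

(** The multiplier in [zlin_prod_branch] does not vanish when [z] is supported on
[2], [E - 2 * l] and [M], where [E] is the size of a bunch and [M] that of the
rest of the tree. This singles out the cuts of one whole bunch and of two
vertices from [l] of its paths; no other term of [zlin_detach_poly] survives. *)
Lemma psum_step l : 1 < l -> l <= minn k alpha ->
  (forall i, i < l -> psum i p = psum i p') -> psum l p = psum l p'.
Proof.
rewrite leq_min => l1 /andP[lk lal] pp'; have [sz al_eq] := sizes_invariant.
pose E := 3 * alpha + 1; pose e := E * (size p - 2) + 2; pose M := e + 3 * alpha.
pose z i : int := Posz [|| i == 2, i == E - 2 * l | i == M].
have MN : M + E = N.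
  by rewrite /M /e /N -/E -[in RHS](subnK p2) mulnDr; rewrite /E; lia.
have z1 : z 1 = 0%R.
  by rewrite /z; case: eqP => //; case: eqP => [|_]; [rewrite /E|case: eqP]; move: N_bound; lia.
have z2 : z 2 = 1%R by [].
have pal2 : all (leq^~ alpha) p' by rewrite al_eq.
have := @zlin_prod_branch _ z torsion_free_int alpha l p p' pal pal2 sz (pp' 1 l1) pp' p2.
have lk1 : l.+1 <= k.+1 by [].
have := eq_cuts z lk1; rewrite -al_eq /PTE_cut_poly => ->; rewrite subrr mul0rn.
rewrite -/E -/e; set c := zlin z _.
have c0 : c != 0%R.
  rewrite /c zlin_detach_poly // big_ord_recl big1 => [|i _].
    rewrite /= !muln0 !subn0 -/E -/M mul1r addr0 /z !eqxx !orbT mulr1.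
    by rewrite natz eqz_nat -lt0n muln_gt0 !ffact_gt0 leqnn leq_subr.
  (* The index lies strictly between [E - 2 * l], which is at least [3], and [M]. *)
  rewrite (_ : z (E - 2 * (l - lift ord0 i)) = 0%R) ?mulr0 ?mul0rn //.
  have il : i < l by []; rewrite lift0 /z (_ : [|| _, _ | _] = false) //.
  apply/negbTE; rewrite !negb_or; have Mb : 3 * alpha + 2 <= M.
    by move: MN N_bound; rewrite /E; lia.
  by apply/and3P; split; apply/eqP; move: Mb; rewrite /E; lia.
move/esym/eqP; rewrite subr_eq0 -[X in X == _]mulr_natr -[X in _ == X]mulr_natr.
by move=> /eqP/(mulfI c0); rewrite !natz => -[].
Qed.

Lemma psum_invariant l : l <= minn k alpha -> psum l p = psum l p'.
Proof.
elim/ltn_ind: l => -[|[|l]] IH lk.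
- by rewrite !psum0; case: sizes_invariant.
- exact: psum1_invariant.
by apply: psum_step => // i il; apply: IH => //; apply: leq_trans (ltnW il) lk.
Qed.

End Invariants.

Lemma sum_Posz l p : (\sum_(x <- map Posz p) x ^+ l)%R = Posz (psum l p).
Proof.
by rewrite big_map /psum -[RHS]natz natr_sum; apply: eq_bigr => a _; rewrite natrX natz.
Qed.

Theorem theorem2p1 (k : nat) (G G' : sgraph)
    (alpha alpha' : nat) (p p' : seq nat) :
  1 <= k ->
  PTE_tree alpha p G ->
  PTE_tree alpha' p' G' ->
  ~ isomorphic G G' ->
  (Upoly k.+1 G = Upoly k.+1 G' ->
     PTE_solutions k (map Posz p) (map Posz p')) /\
  (alpha = alpha' ->
     PTE_solutions k (map Posz p) (map Posz p') ->
     Upoly k.+1 G = Upoly k.+1 G').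
Proof.
move=> k1 PT PT' notiso; split=> [UU'|alE [sz _ sums]]; last first.
  subst alpha'; apply: (psum_Upoly PT PT' k1) => -[_|l lk].
    by move: sz; rewrite !size_map !psum0.
  by have := sums l.+1 lk; rewrite !sum_Posz => -[].
have [[_ cp isoG] [_ cp' isoG']] := (PT, PT').
have eq_w := Upoly_eq_PTE PT PT' UU'.
have [sz alE] := sizes_invariant k1 cp cp' eq_w.
have pp' := psum_invariant k1 cp cp' eq_w.
have not_perm : ~~ perm_eq p p'.
  apply/negP => /(perm_eq_isomorphic alpha) iso; apply: notiso.
  apply: isomorphic_trans isoG (isomorphic_trans iso _).
  by apply: isomorphic_sym; rewrite alE.
split; first by rewrite !size_map.
  by apply: contra not_perm; apply: perm_map_inj => a b [].
move=> l /andP[_ lk]; rewrite !sum_Posz pp' // leq_min lk /=.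
have [//|lal] := leqP l alpha.
(* For [l > alpha] all power sums that matter agree, contradicting [not_perm]. *)
case/negP: not_perm; apply: (psum_perm_eq (alpha := alpha)).
- exact: compatible_all cp.
- by rewrite alE; apply: compatible_all cp'.
by move=> i ial; apply: pp'; rewrite leq_min ial andbT (leq_trans ial) // (leq_trans (ltnW lal)).
Qed.
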